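(* Let $X$ and $Y$ be (possibly infinite) sets and $\varphi\colon Y\to 2^X$ a map. Let $K$ be the simplicial complex on $X$ generated by $\{\varphi(y)\mid y\in Y\}$, i.e. a finite subset $\sigma\subset X$ is a simplex of $K$ if and only if there is $y\in Y$ with $\sigma\subset\varphi(y)$. Let $H$ be the bipartite graph with vertex set $X\sqcup Y$ in which $x\in X$ and $y\in Y$ are adjacent if and only if $x\notin\varphi(y)$ (and there are no other edges). Then $\mathcal{I}(H)\simeq\Sigma K$.
   Context: $2^X$ denotes the power set of $X$. A simplicial complex on a ground set is a family of finite subsets closed under taking subsets, always containing $\emptyset$; homotopy statements refer to geometric realizations, and $\Sigma$ denotes suspension (the suspension of the complex $\{\emptyset\}$ is $S^0$). For a graph $H$, the independence complex $\mathcal{I}(H)$ is the simplicial complex on $V(H)$ whose simplices are the finite subsets containing no two adjacent vertices.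
   Formalization: X is assumed nonempty (and Y is then nonempty because K contains the empty simplex): for X empty and Y nonempty, I(H) is contractible while ΣK is S^0, and for Y empty the claim is likewise false or inconsistent. *)

(* Defs.v *)
From HB Require Import structures.
From mathcomp Require Import all_boot all_order all_algebra.
From mathcomp Require Export finmap.
From mathcomp Require Import generic_quotient.
From mathcomp Require Export all_classical all_reals topology normedtype.

Set Implicit Arguments.
Unset Strict Implicit.
Unset Printing Implicit Defensive.

Import Order.TTheory GRing.Theory Num.Theory.
Import numFieldNormedType.Exports.

Local Open Scope classical_set_scope.
Local Open Scope ring_scope.
Local Open Scope quotient_scope.

Record simplicial_complex (V : choiceType) := SimplicialComplex {
  simplices :> {fset V} -> Prop ;
  simplices_fset0 : simplices fset0 ;
  simplices_subset : forall s t : {fset V},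
    (t `<=` s)%fset -> simplices s -> simplices t }.

Record simple_graph (V : choiceType) := SimpleGraph {
  adjacent :> V -> V -> Prop ;
  adjacent_sym : forall u v, adjacent u v -> adjacent v u ;
  adjacent_irrefl : forall v, ~ adjacent v v }.

Section IndependenceComplex.
Context {V : choiceType} (G : simple_graph V).

Definition independent : set {fset V} :=
  [set s | forall u v, u \in s -> v \in s -> ~ G u v].

Lemma independent_fset0 : independent fset0.
Proof. by move=> u v; rewrite in_fset0. Qed.

Lemma independent_subset (s t : {fset V}) :
  (t `<=` s)%fset -> independent s -> independent t.
Proof. by move=> /fsubsetP ts si u v /ts us /ts vs; exact: si. Qed.

Definition independence_complex : simplicial_complex V :=
  SimplicialComplex independent_fset0 independent_subset.

End IndependenceComplex.

Section NonmembershipGraph.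
Context {X Y : choiceType} (phi : Y -> set X).

Definition nonmember_adj (u v : X + Y) : Prop :=
  match u, v with
  | inl x, inr y | inr y, inl x => ~ phi y x
  | _, _ => False
  end.

Lemma nonmember_adj_sym u v : nonmember_adj u v -> nonmember_adj v u.
Proof. by case: u v => [x|y] [x'|y'] /=. Qed.

Lemma nonmember_adj_irrefl v : ~ nonmember_adj v v.
Proof. by case: v => [x|y] []. Qed.

Definition nonmembership_graph : simple_graph (X + Y)%type :=
  SimpleGraph nonmember_adj_sym nonmember_adj_irrefl.

End NonmembershipGraph.

Section Realization.
Context (R : realType) {V : choiceType} (K : simplicial_complex V).

Definition barycentric_coordinates : set {fsfun V -> R with 0} :=
  [set a | [/\ K (finsupp a), forall v, 0 <= a v &
               \sum_(v <- finsupp a) a v = 1]].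

Definition realization : Type := set_type barycentric_coordinates.

HB.instance Definition _ := Choice.on realization.

(* The weak (coherent) topology: [U] is open iff its trace on each closed
   simplex |s| = {p | supp p \subset s} is relatively open, where |s| carries
   the topology of pointwise convergence; since coordinates outside the finite
   set [s] vanish on |s|, that is the Euclidean topology of |s|. *)
Definition realization_open (U : set realization) : Prop :=
  forall s : {fset V}, K s ->
    exists2 W : set (prod_topology (fun _ : V => R)), open W &
      forall p : realization, (finsupp (val p) `<=` s)%fset ->
        (U p <-> W (fun v => val p v)).

Lemma realization_openT : realization_open setT.
Proof. by move=> s _; exists setT; [exact: openT|]. Qed.

Lemma realization_openI : setI_closed realization_open.
Proof.
move=> A B oA oB s Ks; have [WA oWA AWA] := oA s Ks.
have [WB oWB BWB] := oB s Ks; exists (WA `&` WB); first exact: openI.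
by move=> p ps; split=> -[/(AWA p ps) ? /(BWB p ps) ?].
Qed.

Lemma realization_open_bigU (I : Type) (f : I -> set realization) :
  (forall i, realization_open (f i)) -> realization_open (\bigcup_i f i).
Proof.
move=> of_ s Ks.
have /choice[W WP] i : exists W : set (prod_topology (fun _ : V => R)),
    open W /\ forall p : realization, (finsupp (val p) `<=` s)%fset ->
      (f i p <-> W (fun v => val p v)).
  by have [W oW fW] := of_ i s Ks; exists W.
exists (\bigcup_i W i); first by apply: bigcup_open => i _; have [] := WP i.
move=> p ps; split=> -[i _ ip]; exists i => //; have [_ fW] := WP i.
  exact/(fW p ps).
exact/(fW p ps).
Qed.

HB.instance Definition _ := isOpenTopological.Build realization
  realization_openT realization_openI realization_open_bigU.

End Realization.

Definition unit_interval (R : realType) : topologicalType :=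
  set_type (`[0, 1] : set R).

(* The unreduced suspension of [T], as the quotient of the topological sum of
   T * [0, 1] and the two-point space {false, true} by (x, 0) ~ false and
   (x, 1) ~ true. Adjoining the poles separately makes the suspension of the
   empty space the two-point space S^0. *)
Section Suspension.
Context (R : realType) (T : topologicalType).

Definition suspension_summand (b : bool) : topologicalType :=
  if b then (T * unit_interval R)%type : topologicalType else bool.

Definition suspension_sum : topologicalType := {b : bool & suspension_summand b}.

Definition suspension_pole (p : suspension_sum) : option bool :=
  match p with
  | existT true xt =>
      if set_val xt.2 == 0 :> R then Some false
      else if set_val xt.2 == 1 :> R then Some true else None
  | existT false b => Some b
  end.

Definition suspension_eq (p q : suspension_sum) : bool :=
  (p == q) ||
  (suspension_pole p != None) && (suspension_pole p == suspension_pole q).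

Lemma suspension_eq_refl : reflexive suspension_eq.
Proof. by move=> p; rewrite /suspension_eq eqxx. Qed.

Lemma suspension_eq_sym : symmetric suspension_eq.
Proof.
move=> p q; rewrite /suspension_eq (eq_sym q p).
rewrite (eq_sym (suspension_pole q) (suspension_pole p)).
by case: (eqVneq (suspension_pole p) (suspension_pole q)) => [->|_];
  rewrite ?andbF.
Qed.

Lemma suspension_eq_trans : transitive suspension_eq.
Proof.
move=> q p r /predU1P[->//|/andP[pN /eqP pq]] /predU1P[<-|/andP[_ /eqP qr]].
  by rewrite /suspension_eq pN pq eqxx orbT.
by rewrite /suspension_eq pN pq qr eqxx orbT.
Qed.

Definition suspension_rel :=
  EquivRel _ suspension_eq_refl suspension_eq_sym suspension_eq_trans.

Definition suspension : Type := {eq_quot suspension_rel}.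

HB.instance Definition _ :=
  Topological.copy suspension (quotient_topology {eq_quot suspension_rel}).
HB.instance Definition _ := Quotient.on suspension.

End Suspension.

Definition homotopic (R : realType) (S T : topologicalType) (f g : S -> T) :=
  exists H : S * unit_interval R -> T,
    [/\ continuous H,
        forall x t, set_val t = 0 :> R -> H (x, t) = f x &
        forall x t, set_val t = 1 :> R -> H (x, t) = g x].

Definition homotopy_equivalent (R : realType) (S T : topologicalType) :=
  exists f : S -> T, exists g : T -> S,
    [/\ continuous f, continuous g,
        homotopic R (g \o f) id & homotopic R (f \o g) id].

(* Main.v *)
(* Write a point of |I(H)| as (a, b), with a supported in X and b in Y, and let
   r be the mass of b. For 0 < r < 1 the normalization of a lies in |K|, and
   (a, b) |-> [a/|a|, r] (with r stretched, so that neighborhoods of r = 0 and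
   r = 1 collapse to the poles) maps |I(H)| to the suspension of |K|. In the
   other direction, [q, t] travels from a fixed vertex x0 through alpha(q), then
   beta(q), to a fixed vertex y0, where alpha(q) keeps the large coordinates of
   q and beta(q) is a convex combination of vertices ysel(s), for faces s of the
   carrier of q that contain the support of alpha(q); so alpha(q) and beta(q)
   lie in a common simplex. Both homotopies to the identity move inside
   simplices. Every map to a realization is given by an unnormalized vector with
   polynomial or piecewise linear coefficients, so only its support and its
   nonvanishing need care. Continuity on |K| * [0, 1] is checked on products of
   closed simplices with [0, 1], by Whitehead's argument. *)

Require Import Defs.
From mathcomp Require Import all_boot all_order all_algebra.
From mathcomp Require Import generic_quotient interval_inference lra.
From mathcomp Require Import all_classical.

Set Implicit Arguments.
Unset Strict Implicit.
Unset Printing Implicit Defensive.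

Import Order.TTheory GRing.Theory Num.Theory.
Import numFieldNormedType.Exports.

Local Open Scope classical_set_scope.
Local Open Scope ring_scope.
Local Open Scope quotient_scope.

(** * Final families of maps *)

Section FinalFamily.

(** Equivalently, the disjoint union of the [S k] maps onto [T] by a quotient map. Both the closed
    simplices of a realization and the summands of a suspension are such families. *)
Definition final_family (I : Type) (S : I -> topologicalType)
    (T : topologicalType) (i : forall k, S k -> T) :=
  [/\ forall k, continuous (i k),
      forall x, exists k, exists s, i k s = x &
      forall U : set T, (forall k, open (i k @^-1` U)) -> open U].

Lemma final_continuous (I : Type) (S : I -> topologicalType)
    (T Z : topologicalType) (i : forall k, S k -> T) (f : T -> Z) :
  final_family i -> (forall k, continuous (f \o i k)) -> continuous f.
Proof.
move=> [_ _ fin] cf; apply/continuousP => U oU; apply: fin => k.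
by rewrite -comp_preimage; move/continuousP: (cf k); apply.
Qed.

Definition compact_neighborhoods (C : topologicalType) :=
  forall (c : C) (N : set C), nbhs c N ->
    exists J : set C, [/\ nbhs c J, compact J & J `<=` N].

(* The tube lemma makes [{x | {x} * J `<=` W}] open for compact [J] when [W] is
   open in each [S k * C]. *)
Lemma final_family_prod (C : topologicalType) (I : Type)
    (S : I -> topologicalType) (T : topologicalType) (i : forall k, S k -> T) :
  compact_neighborhoods C -> final_family i ->
  final_family (fun k (q : S k * C) => (i k q.1, q.2)).
Proof.
move=> lcC [ci surj fin]; split.
- move=> k q; apply: cvg_pair; last exact: cvg_snd.
  by apply: (cvg_comp fst (i k)); [exact: cvg_fst|exact: ci].
- by move=> [x c]; have [k [s <-]] := surj x; exists k, (s, c).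
move=> W oW; rewrite openE => -[x c] Wxc.
have [k [s sx]] := surj x; subst x.
have : nbhs (s, c) ((fun q : S k * C => (i k q.1, q.2)) @^-1` W).
  by apply: open_nbhs_nbhs; split; [exact: oW|].
move=> [[A B] /= [As Bc] ABW].
(* A compact [J] in place of [B] leaves an open condition on [x]: that [{x} * J] lies in [W]. *)
have [J [Jc cJ JB]] := lcC _ _ Bc.
exists ([set x | forall c', J c' -> W (x, c')], J) => /=; last first.
  by move=> [x' c'] /= [/[apply]].
split=> //; apply: open_nbhs_nbhs; split; last first.
  move=> c' Jc'; apply: (ABW (s, c')); split => /=; last exact: JB.
  exact: nbhs_singleton.
apply: fin => k'; rewrite openE => s' /= Ws'.
move/compact_near_coveringP: cJ => /(_ _ (nbhs s')
  (fun s2 c2 => W (i k' s2, c2)) _); apply => c' Jc'.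
have : nbhs (s', c') ((fun q : S k' * C => (i k' q.1, q.2)) @^-1` W).
  by apply: open_nbhs_nbhs; split; [exact: oW|exact: Ws'].
move=> [[A' B'] /= [A's B'c] AB'W].
exists (B', A') => //= -[c2 s2] /= [B2 A2].
exact: (AB'W (s2, c2)).
Qed.

End FinalFamily.

(** * The unit interval as a retract of the line *)

Section UnitInterval.
Context {R : realType}.

Definition clamp (x : R) : R := Num.max 0 (Num.min 1 x).

Lemma clamp_itv x : clamp x \in [set` `[0 : R, 1]].
Proof.
apply/mem_set; rewrite /= in_itv /= /clamp le_max lexx /=.
by rewrite ge_max ler01 ge_min lexx.
Qed.

(** Clamping makes this a total retraction, so real formulas give points of the interval without
    range side conditions. *)
Definition to_itv (x : R) : unit_interval R :=
  exist (fun y : R => y \in [set` `[0 : R, 1]]) (clamp x) (clamp_itv x).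

Lemma val_to_itv x : set_val (to_itv x) = clamp x.
Proof. by []. Qed.

Lemma unit_itvP (t : unit_interval R) : 0 <= (set_val t : R) <= 1.
Proof. by have /set_mem := valP t; rewrite /= in_itv. Qed.

Lemma clamp_id (x : R) : 0 <= x <= 1 -> clamp x = x.
Proof. by move=> /andP[x0 x1]; rewrite /clamp (min_idPr x1) (max_idPr x0). Qed.

Lemma to_itvK (t : unit_interval R) : to_itv (set_val t) = t.
Proof. by apply/val_inj; rewrite /= clamp_id// unit_itvP. Qed.

Lemma cvg_max0 (T : topologicalType) (f : T -> R) (q : T) :
  f @ q --> f q -> (fun x => Num.max 0 (f x)) @ q --> Num.max 0 (f q).
Proof.
by move=> cf; apply: (@continuous_max _ _ (cst 0)) => //; exact: cvg_cst.
Qed.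

Lemma cvg_min1 (T : topologicalType) (f : T -> R) (q : T) :
  f @ q --> f q -> (fun x => Num.min 1 (f x)) @ q --> Num.min 1 (f q).
Proof.
by move=> cf; apply: (@continuous_min _ _ (cst 1)) => //; exact: cvg_cst.
Qed.

Lemma cvg_clamp (T : topologicalType) (f : T -> R) (q : T) :
  f @ q --> f q -> (fun x => clamp (f x)) @ q --> clamp (f q).
Proof. by move=> cf; apply: cvg_max0; apply: cvg_min1. Qed.

Lemma cvg_bigsum (T : topologicalType) (I : Type) (s : seq I) (P : pred I)
    (f : I -> T -> R) (q : T) : (forall i, f i @ q --> f i q) ->
  (fun x => \sum_(i <- s | P i) f i x) @ q --> \sum_(i <- s | P i) f i q.
Proof.
move=> cf; elim: s => [|i s IHs].
  by rewrite big_nil; under eq_fun do rewrite big_nil; exact: cvg_cst.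
rewrite big_cons; under eq_fun do rewrite big_cons.
by case: (P i) => //; exact: cvgD.
Qed.

Lemma cvg_bigprod (T : topologicalType) (I : Type) (s : seq I)
    (f : I -> T -> R) (q : T) : (forall i, f i @ q --> f i q) ->
  (fun x => \prod_(i <- s) f i x) @ q --> \prod_(i <- s) f i q.
Proof.
move=> cf; elim: s => [|i s IHs].
  by rewrite big_nil; under eq_fun do rewrite big_nil; exact: cvg_cst.
by rewrite big_cons; under eq_fun do rewrite big_cons; exact: cvgM.
Qed.

Lemma to_itv_continuous : continuous to_itv.
Proof.
apply: continuous_comp_initial => x.
by apply: (@cvg_clamp _ id); exact: cvg_id.
Qed.

Lemma set_val_continuous (A : set R) : continuous (set_val : A -> R).
Proof. exact: initial_continuous. Qed.

Lemma cvg_set_val (T : topologicalType) (g : T -> unit_interval R) (z : T) :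
  g @ z --> g z -> (fun w => set_val (g w) : R) @ z --> (set_val (g z) : R).
Proof. by move=> cg; apply: continuous_comp; last exact: set_val_continuous. Qed.

(** The retraction [to_itv] carries a closed ball around [c] to a compact neighborhood of [c] in the
    interval. *)
Lemma unit_interval_compact_neighborhoods :
  compact_neighborhoods (unit_interval R).
Proof.
move=> c N Nc.
have : nbhs (set_val c : R) (to_itv @^-1` N).
  by apply: to_itv_continuous; rewrite to_itvK.
move=> /nbhs_closedballP[] e eN.
exists (to_itv @` closed_ball (set_val c) e%:num); split.
- have cJ : nbhs c (set_val @^-1` closed_ball (set_val c : R) e%:num).
    by apply: set_val_continuous; apply/nbhs_closedballP; exists e.
  apply: filterS cJ => d cd.
  by exists (set_val d) => //; exact: to_itvK.
- apply: continuous_compact; last exact: closed_ballR_compact.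
  exact/continuous_subspaceT/to_itv_continuous.
- by move=> _ [x /eN xN <-].
Qed.

End UnitInterval.

(** * Continuity of maps to and from realizations *)

Section Realization.
Context {R : realType} {V : choiceType} {K : simplicial_complex V}.
Implicit Types (p q : realization R K) (s t : {fset V}) (a : V -> R).

Definition bary p (v : V) : R := (val p : {fsfun V -> R with 0}) v.

Definition carrier p : {fset V} := finsupp (val p : {fsfun V -> R with 0}).

Lemma realizationP p : [/\ K (carrier p), forall v, 0 <= bary p v &
  \sum_(v <- carrier p) bary p v = 1].
Proof. exact: set_mem (valP p). Qed.

Lemma bary_ge0 p v : 0 <= bary p v.
Proof. by have [_ ->] := realizationP p. Qed.

Lemma carrier_simplex p : K (carrier p).
Proof. by have [] := realizationP p. Qed.

Lemma bary_eq0 p v : v \notin carrier p -> bary p v = 0.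
Proof. exact: fsfun_dflt. Qed.

Lemma mem_carrier p v : (v \in carrier p) = (bary p v != 0).
Proof. exact: mem_finsupp. Qed.

Lemma bary_sum p s : (carrier p `<=` s)%fset -> \sum_(v <- s) bary p v = 1.
Proof.
move=> ps; have [_ _ <-] := realizationP p; symmetry.
by apply: big_fset_incl => // v _; exact: bary_eq0.
Qed.

Lemma bary_inj p q : bary p =1 bary q -> p = q.
Proof. by move=> pq; apply/val_inj/fsfunP. Qed.

Lemma simplex_of_pos p s : (forall v, v \in s -> 0 < bary p v) -> K s.
Proof.
move=> sp; apply: simplices_subset (carrier_simplex p).
by apply/fsubsetP => v /sp v0; rewrite mem_carrier gt_eqF.
Qed.

(** Points are handled through unnormalized coordinates: [a] is a positive multiple of the
    barycentric coordinates of [p]. This keeps quotients out of the formulas for maps. *)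
Definition ray p a := exists2 c, 0 < c & forall v, a v = c * bary p v.

Lemma ray_bary p : ray p (bary p).
Proof. by exists 1 => // v; rewrite mul1r. Qed.

Lemma eq_ray p a b : a =1 b -> ray p a -> ray p b.
Proof. by move=> ab [c c0 pa]; exists c => // v; rewrite -ab. Qed.

(** Summing [a] over a finite set containing both carriers recovers either scalar, so the two
    scalars agree. *)
Lemma ray_unique p q a : ray p a -> ray q a -> p = q.
Proof.
move=> [c c0 ap] [d d0 aq]; apply: bary_inj => v.
have cd : c = d.
  have := fsubsetUl (carrier p) (carrier q).
  have := fsubsetUr (carrier p) (carrier q).
  move: (_ `|` _)%fset => s /bary_sum sq /bary_sum sp.
  rewrite -[RHS]mulr1 -sq mulr_sumr -[LHS]mulr1 -sp mulr_sumr.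
  by apply: eq_bigr => x _; rewrite -ap -aq.
by apply: (@mulfI _ c); rewrite ?gt_eqF// -ap aq cd.
Qed.

(** The point is [a] divided by its total over [s]; the last hypothesis makes its support a
    simplex. *)
Lemma ray_exists s a : (forall v, 0 <= a v) ->
    (forall v, v \notin s -> a v = 0) -> (exists v, 0 < a v) ->
    (forall t, (forall v, v \in t -> 0 < a v) -> K t) ->
  exists p, ray p a.
Proof.
move=> a0 as0 [v v0] aK.
pose c := \sum_(x <- s) a x.
have c0 : 0 < c.
  have vs : v \in s.
    by apply: contraT => /as0 av; rewrite av ltxx in v0.
  by rewrite /c (big_fsetD1 v)//= ltr_pwDl// sumr_ge0.
pose f := [fsfun x in s => a x / c | 0 : R] : {fsfun V -> R with 0}.
have fE x : f x = a x / c.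
  by rewrite fsfun_fun; case: ifPn => // /as0 ->; rewrite mul0r.
have fs : (finsupp f `<=` s)%fset by exact: finsupp_sub.
have Kf : barycentric_coordinates K f.
  split.
  - apply: aK => x; rewrite mem_finsupp fE => fx.
    rewrite lt_neqAle a0 andbT eq_sym.
    by apply: contraNneq fx => ->; rewrite mul0r.
  - by move=> x; rewrite fE divr_ge0// ltW.
  - rewrite (@big_fset_incl _ _ _ _ _ _ _ fs).
      by under eq_bigr do rewrite fE; rewrite -mulr_suml divff// gt_eqF.
    by move=> x _; exact: fsfun_dflt.
exists (exist (fun x => x \in barycentric_coordinates K) f (mem_set Kf)).
by exists c => // x; rewrite /bary /= fE mulrCA divff ?mulr1// gt_eqF.
Qed.

(* On the realization of a finite subcomplex, which is a finite union of closed
   simplices, the weak topology is the one of pointwise convergence. *)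
Lemma open_finite_trace (U : set (realization R K)) (t : {fset V}) :
  open U ->
  exists2 W : set (prod_topology (fun _ : V => R)), open W &
    forall p, (carrier p `<=` t)%fset -> (U p <-> W (bary p)).
Proof.
move=> oU.
have /choice[W WP] (s : {fset V}) :
    exists W : set (prod_topology (fun _ : V => R)), open W /\
      (K s -> forall p, (carrier p `<=` s)%fset -> (U p <-> W (bary p))).
  have [Ks|nKs] := pselect (K s); last by exists setT; split => //; exact: openT.
  by have [W oW WU] := oU s Ks; exists W; split => // _; exact: WU.
(* [N s] accepts every vector with a nonzero coordinate outside [s], so it constrains only the
   points carried by [s]. Finitely many [s] lie in [t], and the intersection of their [N s] stays
   open. *)
pose N s : set (prod_topology (fun _ : V => R)) :=
  W s `|` \bigcup_(v in [set v | v \notin s]) [set a | a v != 0].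
have oN s : open (N s).
  apply: openU; first by have [] := WP s.
  apply: bigcup_open => v _.
  apply: (@open_comp _ _ (fun a : prod_topology (fun _ : V => R) => a v)
    [set x : R | x != 0]); last exact: open_neq.
  by move=> a _; apply: (@proj_continuous V (fun=> R) v).
exists (\bigcap_(s in [set` [fset s in fpowerset t | `[< K s >]]%fset]) N s).
  rewrite openE => a Na; apply: filter_bigI => s st.
  by apply: open_nbhs_nbhs; split; [exact: oN|exact: Na].
move=> p pt; split.
  move=> Up s /=; rewrite !inE => /andP[_ /asboolP Ks].
  have [ps|/fsubsetPn[v vp vs]] := boolP (carrier p `<=` s)%fset.
    by left; apply/(WP s).2.
  by right; exists v => //=; rewrite -mem_carrier.
(* Among the faces, the carrier of [p] itself decides: no coordinate of [p] outside it is
   nonzero. *)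
move=> /(_ (carrier p)) /=; rewrite !inE fpowersetE pt /=.
move=> /(_ (asboolT (carrier_simplex p))) [|[v /= vp]].
  by move/((WP _).2 (carrier_simplex p) p (fsubset_refl _)).
by rewrite -mem_carrier (negPf vp).
Qed.

(** Near [x] the values stay in the finite subcomplex on [t], where open sets are traces of
    pointwise open ones. The set [t] may fail to be a simplex. *)
Lemma cvg_bary (T : topologicalType) (f : T -> realization R K) (x : T) t :
  (\forall y \near x, (carrier (f y) `<=` t)%fset) ->
  (forall v, (fun y => bary (f y) v) @ x --> bary (f x) v) ->
  f @ x --> f x.
Proof.
move=> ft cf U fxU; suff: nbhs x (f @^-1` U) by [].
have [U' [oU' U'x] U'U] : exists2 U', open_nbhs (f x) U' & U' `<=` U.
  by move: fxU; rewrite nbhsE.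
have [W oW WU] := open_finite_trace t oU'.
have cW : (fun y => bary (f y) : prod_topology (fun _ : V => R)) @ x -->
    (bary (f x) : prod_topology (fun _ : V => R)).
  apply/cvg_sup => v B [B' [[C oC <-] Cv] BC].
  apply: (filterS BC) _; apply: (cf v).
  exact: open_nbhs_nbhs.
have fxt := nbhs_singleton ft.
have Wx : nbhs (bary (f x) : prod_topology (fun _ : V => R)) W.
  by apply: open_nbhs_nbhs; split => //; apply/WU.
have {}cW : nbhs x [set y | W (bary (f y))] := cW _ Wx.
near=> y; apply: U'U; apply/WU; first by near: y.
by near: y.
Unshelve. all: by end_near.
Qed.

(** Dividing by the total over [t], which is continuous and nonzero at [x], turns the coefficients
    into barycentric coordinates. *)
Lemma cvg_ray (T : topologicalType) (f : T -> realization R K)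
    (a : T -> V -> R) (x : T) t :
  (\forall y \near x, ray (f y) (a y)) ->
  (\forall y \near x, forall v, v \notin t -> a y v = 0) ->
  (forall v, (fun y => a y v) @ x --> a x v) ->
  f @ x --> f x.
Proof.
move=> fa at0 ca.
have fE : \forall y \near x, (carrier (f y) `<=` t)%fset /\
    forall v, bary (f y) v = a y v / \sum_(w <- t) a y w.
  apply: (@filterS2 _ (nbhs x) _ _ _ _ _ fa at0) => y [c c0 ay] ay0.
  have st : (carrier (f y) `<=` t)%fset.
    apply/fsubsetP => v; rewrite mem_carrier; apply: contraNT => /ay0 /eqP.
    by rewrite ay mulf_eq0 gt_eqF.
  split=> // v; under eq_bigr do rewrite ay.
  by rewrite -mulr_sumr bary_sum// mulr1 ay mulrAC divff ?mul1r// gt_eqF.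
have sum0 : \sum_(w <- t) a x w != 0.
  have [st _] := nbhs_singleton fE; have [c c0 ay] := nbhs_singleton fa.
  under eq_bigr do rewrite ay.
  by rewrite -mulr_sumr bary_sum// mulr1 gt_eqF.
apply: (@cvg_bary _ _ _ t).
  by apply: (@filterS _ (nbhs x) _ _ _ _ fE) => y [].
move=> v; rewrite (nbhs_singleton fE).2.
apply: (@cvg_trans _ ((fun y => a y v / \sum_(w <- t) a y w) @ x)).
  apply: near_eq_cvg; apply: (@filterS _ (nbhs x) _ _ _ _ fE) => y [_ ->//].
apply: cvgM => //; apply: cvgV => //.
exact: cvg_bigsum.
Qed.

Definition closed_simplex s : topologicalType :=
  initial_topology (fun p : {p : realization R K | (carrier p `<=` s)%fset} =>
    bary (val p) : prod_topology (fun _ : V => R)).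

Definition simplex_incl s (p : closed_simplex s) : realization R K :=
  val (p : {p : realization R K | (carrier p `<=` s)%fset}).

Lemma carrier_simplex_incl s (p : closed_simplex s) :
  (carrier (simplex_incl p) `<=` s)%fset.
Proof. exact: (valP (p : {p : realization R K | (carrier p `<=` s)%fset})). Qed.

Lemma bary_simplex_continuous s v :
  continuous (fun p : closed_simplex s => bary (simplex_incl p) v).
Proof.
move=> p; apply: (@continuous_comp _ _ _
  (fun p : closed_simplex s =>
     bary (simplex_incl p) : prod_topology (fun _ : V => R))
  (fun a : prod_topology (fun _ : V => R) => a v)).
  exact: initial_continuous.
exact: (@proj_continuous V (fun=> R) v).
Qed.

Lemma closed_simplex_final :
  final_family (fun (s : {s | K s}) => @simplex_incl (sval s)).
Proof.
split.
- move=> s p; apply: (@cvg_bary _ _ _ (sval s)).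
    by apply: (@filterE _ (nbhs p)) => q; exact: carrier_simplex_incl.
  by move=> v; exact: bary_simplex_continuous.
- move=> p; exists (exist _ _ (carrier_simplex p)).
  by exists (exist _ p (fsubset_refl _)).
move=> U oU; suff: realization_open U by [].
move=> s Ks; have [W oW WU] := oU (exist _ s Ks).
exists W => // p ps.
move/seteqP: WU => -[WU UW].
split; [exact: (UW (exist _ p ps))|exact: (WU (exist _ p ps))].
Qed.

(** It suffices to test on products of a closed simplex with [C]. The space [T] stands for such a
    product and retains only what continuity proofs use: a common finite carrier and convergent
    coordinates. *)
Lemma realization_prod_continuous (C Z : topologicalType)
    (f : realization R K * C -> Z) : compact_neighborhoods C ->
    (forall (T : topologicalType) (inc : T -> realization R K) (g : T -> C)
        (s : {fset V}) (z : T), (forall y, (carrier (inc y) `<=` s)%fset) ->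
        (forall v, (fun y => bary (inc y) v) @ z --> bary (inc z) v) ->
        g @ z --> g z ->
      (fun y => f (inc y, g y)) @ z --> f (inc z, g z)) ->
  continuous f.
Proof.
move=> cC cf.
apply: (final_continuous (final_family_prod cC closed_simplex_final)) => s z.
apply: (cf _ (fun w : closed_simplex (sval s) * C => simplex_incl w.1) snd
  (sval s) z).
- by move=> y; exact: carrier_simplex_incl.
- move=> v; apply: (cvg_comp fst (fun w => bary (simplex_incl w) v)).
    exact: cvg_fst.
  exact: bary_simplex_continuous.
- exact: cvg_snd.
Qed.

End Realization.

(** * Suspensions *)

Lemma nbhs_bool (b : bool) : nbhs b [set b].
Proof. by rewrite nbhs_principalE; exact/principal_filterP. Qed.

Lemma bool_continuous (Z : topologicalType) (f : bool -> Z) : continuous f.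
Proof.
move=> b U fU; suff: nbhs b (f @^-1` U) by [].
by rewrite nbhs_principalE; apply/principal_filterP; exact: nbhs_singleton fU.
Qed.

Section Suspension.
Context {R : realType} {T : topologicalType}.
Local Notation I := (unit_interval R).

Definition meridian (x : T) (t : I) : suspension R T :=
  \pi_(suspension R T) (existT (suspension_summand R T) true (x, t)).

Definition pole (b : bool) : suspension R T :=
  \pi_(suspension R T) (existT (suspension_summand R T) false b).

Lemma meridian0 x (t : I) : set_val t = 0 :> R -> meridian x t = pole false.
Proof.
move=> t0; apply/eqmodP; rewrite /= /suspension_eq /suspension_pole /=.
by rewrite t0 !eqxx.
Qed.

Lemma meridian1 x (t : I) : set_val t = 1 :> R -> meridian x t = pole true.
Proof.
move=> t1; apply/eqmodP; rewrite /= /suspension_eq /suspension_pole /=.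
by rewrite t1 oner_eq0 !eqxx.
Qed.

Lemma suspension_final : final_family
  (fun b (x : suspension_summand R T b) => \pi_(suspension R T) (existT _ b x)).
Proof.
split.
- move=> b x; apply: (@continuous_comp _ _ _
    (existT (suspension_summand R T) b) \pi_(suspension R T)).
    exact: existT_continuous.
  exact: (@pi_continuous _ {eq_quot suspension_rel R T}).
- by move=> w; case E: (repr w) => [b x]; exists b, x; rewrite -E reprK.
move=> U oU; suff: open (\pi_(suspension R T) @^-1` U) by [].
by apply/sigT_openP => b; exact: oU.
Qed.

Lemma meridian_continuous : continuous (fun q : T * I => meridian q.1 q.2).
Proof.
have [cpi _ _] := suspension_final.
rewrite (_ : (fun q => _) = fun q : T * I => \pi_(suspension R T)
    (existT (suspension_summand R T) true q)); first exact: (cpi true).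
by apply/funext => -[].
Qed.

Lemma cvg_meridian (Z : topologicalType) (f : Z -> T) (g : Z -> I) (z : Z) :
    f @ z --> f z -> g @ z --> g z ->
  (fun w => meridian (f w) (g w)) @ z --> meridian (f z) (g z).
Proof.
move=> cf cg; apply: (cvg_comp (fun w => (f w, g w))
  (fun q : T * I => meridian q.1 q.2)).
  by apply: (@cvg_pair _ _ _ (nbhs z) (nbhs (f z)) (nbhs (g z))).
exact: (meridian_continuous (x := (f z, g z))).
Qed.

(** The form of homotopy used on the suspension: [f] moves the base point while the height goes
    linearly from [g] to the original height. *)
Lemma meridian_homotopy_continuous (f : T * I -> T) (g : T * I -> R) :
  continuous f -> continuous g ->
  continuous (fun r : T * I * I => meridian (f (r.1.1, r.2))
    (to_itv ((1 - set_val r.2) * g r.1 + set_val r.2 * set_val r.1.2))).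
Proof.
move=> cf cg z.
have c11 : (fun r : T * I * I => r.1.1) @ z --> z.1.1.
  by apply: (cvg_comp fst fst); exact: cvg_fst.
have c12 : (fun r : T * I * I => r.1.2) @ z --> z.1.2.
  by apply: (cvg_comp fst snd); [exact: cvg_fst|exact: cvg_snd].
have c2 : (fun r : T * I * I => r.2) @ z --> z.2 by exact: cvg_snd.
have cs := cvg_set_val c2.
apply: cvg_meridian.
  apply: (cvg_comp (fun r : T * I * I => (r.1.1, r.2)) f _ (cf _)).
  exact: (@cvg_pair _ _ _ (nbhs z) (nbhs z.1.1) (nbhs z.2)).
apply: (cvg_comp _ to_itv); last exact: to_itv_continuous.
apply: cvgD; last by apply: cvgM => //; exact: cvg_set_val.
apply: cvgM; first by apply: cvgB => //; exact: cvg_cst.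
by apply: (cvg_comp fst g); [exact: cvg_fst|exact: cg].
Qed.

Definition suspension_rec (Z : Type) (f : T -> I -> Z) (z : bool -> Z)
    (w : suspension R T) : Z :=
  match repr w with
  | existT true xt => f xt.1 xt.2
  | existT false b => z b
  end.

Section Rec.
Variables (Z : Type) (f : T -> I -> Z) (z : bool -> Z).
Hypothesis f0 : forall x t, set_val t = 0 :> R -> f x t = z false.
Hypothesis f1 : forall x t, set_val t = 1 :> R -> f x t = z true.

Lemma suspension_rec_pi p : suspension_rec f z (\pi_(suspension R T) p) =
  match p with existT true xt => f xt.1 xt.2 | existT false b => z b end.
Proof.
pose F (p : suspension_sum R T) :=
  match p with existT true xt => f xt.1 xt.2 | existT false b => z b end.
(* On glued points the value depends only on the pole, by [f0] and [f1]; hence the chosen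
   representative is immaterial. *)
have FP q : suspension_pole q != None ->
    F q = z (odflt false (suspension_pole q)).
  case: q => -[[x t]|b] //=.
  have [t0 _|_] := eqVneq (set_val t : R) 0; first by rewrite (f0 _ t0).
  by have [t1 _|//] := eqVneq (set_val t : R) 1; rewrite (f1 _ t1).
rewrite -[LHS]/(F (repr _)) -[RHS]/(F p).
have /eqmodP := reprK (\pi_(suspension R T) p).
move=> /orP[/eqP -> //|/andP[q0 /eqP qp]].
by rewrite !FP ?qp// -qp.
Qed.

Lemma suspension_rec_meridian x t : suspension_rec f z (meridian x t) = f x t.
Proof. exact: suspension_rec_pi. Qed.

Lemma suspension_rec_pole b : suspension_rec f z (pole b) = z b.
Proof. exact: suspension_rec_pi. Qed.

End Rec.

Lemma suspension_case (P : suspension R T -> Prop) :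
  (forall x t, P (meridian x t)) -> (forall b, P (pole b)) -> forall w, P w.
Proof.
move=> Pm Pp w; rewrite -(reprK w).
by case: (repr w) => -[[x t]|b]; [exact: Pm|exact: Pp].
Qed.

Lemma suspension_continuous (Z : topologicalType) (f : suspension R T -> Z) :
  continuous (fun q : T * I => f (meridian q.1 q.2)) -> continuous f.
Proof.
move=> cf; apply: (final_continuous suspension_final) => -[] /=.
  rewrite (_ : _ \o _ = fun q : T * I => f (meridian q.1 q.2))//.
  by apply/funext => -[].
exact: bool_continuous.
Qed.

(** The interval has compact neighborhoods, so the product of the suspension with it is still a
    quotient of the product of the two summands with it. *)
Lemma suspension_homotopy_continuous (Z : topologicalType)
    (h : suspension R T * I -> Z) :
  continuous (fun q : T * I * I => h (meridian q.1.1 q.1.2, q.2)) ->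
  (forall b, continuous (fun s : I => h (pole b, s))) ->
  continuous h.
Proof.
move=> cm cp; apply: (final_continuous (final_family_prod
  unit_interval_compact_neighborhoods suspension_final)) => -[] /=.
  rewrite (_ : _ \o _ = fun q : T * I * I => h (meridian q.1.1 q.1.2, q.2))//.
  by apply/funext => -[[]].
move=> [b s] U /(cp b s) Us.
exists ([set b], (fun s : I => h (pole b, s)) @^-1` U) => /=.
  by split; [exact: nbhs_bool|].
by move=> [c s'] /= [-> ].
Qed.

End Suspension.

(** * Explicit paths in barycentric coordinates *)

Section PosPart.
Context {R : realType}.
Implicit Types (x c : R).

Definition pos x : R := Num.max 0 x.

Lemma pos_ge0 x : 0 <= pos x.
Proof. by rewrite le_max lexx. Qed.

Lemma pos_gt0 x : (0 < pos x) = (0 < x).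
Proof. by rewrite lt_max ltxx. Qed.

Lemma pos_eq0 x : x <= 0 -> pos x = 0.
Proof. by move=> ?; apply/max_idPl. Qed.

Definition capped x : R := Num.min 1 (pos x).

Lemma capped_ge0 x : 0 <= capped x.
Proof. by rewrite le_min ler01 pos_ge0. Qed.

Lemma capped_gt0 x : (0 < capped x) = (0 < x).
Proof. by rewrite lt_min ltr01 pos_gt0. Qed.

Lemma capped_eq1 x : 1 <= x -> capped x = 1.
Proof.
by move=> x1; apply/min_idPl; rewrite /pos (max_idPr _)// (le_trans ler01).
Qed.

Lemma mul_gt0_nneg x c : 0 <= x -> 0 <= c -> 0 < x * c -> 0 < x /\ 0 < c.
Proof.
rewrite !le_eqVlt => /predU1P[<-|->]; first by rewrite mul0r ltxx.
by move=> /predU1P[<-|->]; first by rewrite mulr0 ltxx.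
Qed.

End PosPart.

(** * Large coordinates and weights on faces *)

Section SubdivisionWeights.
Context {R : realType} {X Y : choiceType} (ysel : {fset X} -> Y).
Implicit Types (u s : {fset X}) (c : X -> R).

Definition sqsum u c := \sum_(x <- u) c x ^+ 2.

(** The threshold is half of [sqsum u c]. For coordinates of total one, [sqsum u c] is their mean
    weighted by [c] itself, so the largest coordinate always survives. *)
Definition alpha u c x := pos (2 * c x - sqsum u c).

(* Positive exactly when all the coordinates in [s] are positive and those
   outside [s] have total less than [sqsum u c / 2]; hence [s] then contains
   the support of [alpha u c]. *)
Definition weight u c s :=
  (\prod_(x <- s) c x) * pos (sqsum u c - 2 * (1 - \sum_(x <- s) c x)).

(** The weights of the faces, pushed forward along [ysel]. *)
Definition beta u c y := \sum_(s <- fpowerset u | ysel s == y) weight u c s.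

Lemma sqsum_ge0 u c : 0 <= sqsum u c.
Proof. by apply: sumr_ge0 => x _; exact: sqr_ge0. Qed.

Lemma alpha_ge0 u c x : 0 <= alpha u c x.
Proof. exact: pos_ge0. Qed.

Lemma alpha_gt0 u c x : 0 < alpha u c x -> 0 < c x.
Proof. by rewrite pos_gt0 => ?; have := sqsum_ge0 u c; lra. Qed.

Lemma weight_ge0 u c s : (forall x, 0 <= c x) -> 0 <= weight u c s.
Proof. by move=> c0; rewrite mulr_ge0 ?pos_ge0// prodr_ge0. Qed.

Lemma beta_ge0 u c y : (forall x, 0 <= c x) -> 0 <= beta u c y.
Proof. by move=> c0; apply: sumr_ge0 => s _; exact: weight_ge0. Qed.

Lemma weight_gt0 u c s : (forall x, 0 <= c x) -> 0 < weight u c s ->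
  (forall x, x \in s -> 0 < c x) /\ 2 * (1 - \sum_(x <- s) c x) < sqsum u c.
Proof.
move=> c0 /mul_gt0_nneg[]; rewrite ?pos_ge0 ?prodr_ge0//.
rewrite pos_gt0 subr_gt0 => p0 ?; split=> // x xs.
rewrite lt_neqAle c0 andbT; apply: contraTneq p0 => cx.
by rewrite (big_fsetD1 x)//= -cx mul0r ltxx.
Qed.

Lemma beta_gt0 u c y : (forall x, 0 <= c x) -> 0 < beta u c y ->
  exists s, [/\ (s `<=` u)%fset, ysel s = y & 0 < weight u c s].
Proof.
move=> c0 b0; apply: contrapT => nex.
move: b0; rewrite /beta big_seq_cond big1 ?ltxx// => s.
rewrite fpowersetE => /andP[su /eqP sy]; apply/eqP.
rewrite eq_le weight_ge0// andbT leNgt; apply/negP => w0.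
by apply: nex; exists s.
Qed.

Lemma ler_sum_fset s u c : (forall x, 0 <= c x) -> (s `<=` u)%fset ->
  \sum_(x <- s) c x <= \sum_(x <- u) c x.
Proof.
move=> c0 su; pose d x := if x \in s then c x else 0.
rewrite (_ : \sum_(x <- s) c x = \sum_(x <- u) d x).
  by apply: ler_sum => x _; rewrite /d; case: ifP.
transitivity (\sum_(x <- s) d x).
  by apply: eq_big_seq => x xs; rewrite /d xs.
by apply: big_fset_incl => // x _ xs; rewrite /d (negPf xs).
Qed.

(** For [x] outside [s], [c x] is at most the total outside [s], hence below half of [sqsum u c],
    and [alpha] vanishes at [x]. *)
Lemma weight_alpha u c s x : (forall x, 0 <= c x) ->
    (forall x, x \notin u -> c x = 0) -> \sum_(x <- u) c x = 1 ->
    (s `<=` u)%fset -> 0 < weight u c s -> 0 < alpha u c x ->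
  x \in s.
Proof.
move=> c0 cu c1 su /(weight_gt0 c0)[_ ws] ax; apply: contraT => xs.
have xu : x \in u.
  by apply: contraT => /cu cx; have := alpha_gt0 ax; rewrite cx ltxx.
have : c x + \sum_(z <- s) c z <= 1.
  rewrite -c1 (big_fsetD1 x xu)/= lerD2l ler_sum_fset//.
  apply/fsubsetP => z zs; rewrite !inE (fsubsetP su _ zs) andbT.
  by apply: contraNneq xs => <-.
by move: ax; rewrite pos_gt0; lra.
Qed.

Lemma sqsum_gt0 u c : (forall x, 0 <= c x) -> \sum_(x <- u) c x = 1 ->
  0 < sqsum u c.
Proof.
move=> c0 c1; rewrite lt_neqAle sqsum_ge0 andbT eq_sym; apply/negP => /eqP q0.
suff : \sum_(x <- u) c x = 0 by rewrite c1 => /eqP; rewrite oner_eq0.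
rewrite big_seq big1// => x xu.
move/eqP: q0; rewrite /sqsum psumr_eq0 => [|z _]; last exact: sqr_ge0.
by move=> /allP/(_ _ xu)/=; rewrite sqrf_eq0 => /eqP.
Qed.

(** If every [2 * c x] were at most [sqsum u c], averaging with weights [c x] would give
    [2 * sqsum u c <= sqsum u c], although [sqsum u c] is positive. *)
Lemma alpha_exists u c : (forall x, 0 <= c x) -> \sum_(x <- u) c x = 1 ->
  exists x, 0 < alpha u c x.
Proof.
move=> c0 c1; have q0 := sqsum_gt0 c0 c1.
apply: contrapT => nex.
have le x : 2 * c x <= sqsum u c.
  rewrite leNgt; apply/negP => h; apply: nex; exists x.
  by rewrite pos_gt0 subr_gt0.
have : \sum_(x <- u) c x * (2 * c x) <= \sum_(x <- u) c x * sqsum u c.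
  by apply: ler_sum => x _; exact: ler_wpM2l.
rewrite -mulr_suml c1 mul1r.
under eq_bigr do rewrite mulrCA -expr2.
by rewrite -mulr_sumr -/(sqsum u c); lra.
Qed.

Lemma beta_exists u c : (forall x, 0 <= c x) -> \sum_(x <- u) c x = 1 ->
  exists y, 0 < beta u c y.
Proof.
(* The whole support of [c] leaves no mass outside, so its weight is positive. *)
move=> c0 c1; pose s := [fset x in u | 0 < c x]%fset.
have su : (s `<=` u)%fset by apply/fsubsetP => x; rewrite !inE => /andP[].
have s1 : \sum_(x <- s) c x = 1.
  rewrite -c1; apply: big_fset_incl => // x xu.
  by rewrite !inE xu /= lt_neqAle c0 andbT negbK => /eqP.
have w0 : 0 < weight u c s.
  rewrite /weight s1 subrr mulr0 subr0 mulr_gt0 ?pos_gt0 ?sqsum_gt0//.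
  by rewrite big_seq prodr_gt0// => x; rewrite !inE => /andP[].
exists (ysel s); rewrite /beta big_mkcond (big_fsetD1 s) ?fpowersetE//= eqxx.
by rewrite ltr_pwDl// sumr_ge0// => z _; case: ifP => // _; exact: weight_ge0.
Qed.

Section Extension.
Variables (u u' : {fset X}) (c : X -> R).
Hypothesis uu' : (u `<=` u')%fset.
Hypothesis cu : forall x, x \notin u -> c x = 0.

(** The carrier varies with the point. This and the next two lemmas replace it by a fixed larger
    set, over which the formulas are visibly continuous. *)
Lemma sqsum_incl : sqsum u c = sqsum u' c.
Proof. by apply: big_fset_incl => // x _ /cu ->; rewrite expr0n. Qed.

Lemma alpha_incl : alpha u c =1 alpha u' c.
Proof. by move=> x; rewrite /alpha sqsum_incl. Qed.

Lemma beta_incl : beta u c =1 beta u' c.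
Proof.
move=> y; rewrite /beta big_mkcond [RHS]big_mkcond.
rewrite (eq_bigr (fun s => if ysel s == y then weight u' c s else 0)); last first.
  by move=> s _; rewrite /weight sqsum_incl.
apply: big_fset_incl; first by rewrite fpowersetS.
(* A face that leaves [u] has a vanishing coordinate, which kills the product in its weight. *)
move=> s _; rewrite fpowersetE => /fsubsetPn[x xs /cu cx].
by case: ifP => // _; rewrite /weight (big_fsetD1 x)//= cx !mul0r.
Qed.

End Extension.

End SubdivisionWeights.

(** * The path from [x0] to [y0] and its deformation *)

Section PathVector.
Context {R : realType} {X Y : choiceType} (ysel : {fset X} -> Y).
Variables (x0 : X) (y0 : Y).
Implicit Types (t s : R) (u : {fset X}) (c a : X -> R) (b : Y -> R).

(** At [s = 0] the terms x0, alpha, beta, y0 are present for [t < 1/3], [0 < t < 2/3], [1/3 < t < 1]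
    and [2/3 < t]. The factors [t] and [1 - t] make the two ends exactly the vertices [x0] and
    [y0]. *)
Definition coef_x0 t s : R := pos (1 - 3 * t - 3 * s).
Definition coef_alpha t s : R := (1 - s) * t * pos (2 - 3 * t).
Definition coef_beta t s : R := (1 - t) * pos (3 * t - 1 - 3 * s).
Definition coef_y0 t s : R := pos (3 * t - 2 - 3 * s).
Definition coef_a t s : R := s * capped (1 + 3 * s - 3 * t).
Definition coef_b t s : R := s * capped (3 * t + 3 * s - 1).

(* On the unit square the zero sets of the coefficients are arranged so that the
   terms present at (t, s) always span a simplex: the candidates are
   {x0, alpha, a}, {alpha, a, b}, {alpha, beta, b} and {beta, y0, b}. At [s = 0]
   this is the path x0, alpha, beta, y0; at [s = 1] it is a + b. *)
Definition path_vector u c a b t s (v : X + Y) : R :=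
  match v with
  | inl x => coef_x0 t s * (x == x0)%:R + coef_alpha t s * alpha u c x +
             coef_a t s * a x
  | inr y => coef_beta t s * beta ysel u c y + coef_y0 t s * (y == y0)%:R +
             coef_b t s * b y
  end.

(** One finite set for all [t] and [s], as [cvg_ray] requires. *)
Definition path_support u (w : {fset Y}) : {fset X + Y} :=
  ([fset inl x | x in x0 |` u] `|`
   [fset inr y | y in y0 |` (w `|` [fset ysel s | s in fpowerset u])])%fset.

Lemma path_vector_support u w c a b t s :
    (forall x, x \notin u -> c x = 0) -> (forall x, x \notin u -> a x = 0) ->
    (forall y, y \notin w -> b y = 0) -> (forall x, 0 <= c x) ->
  forall v, v \notin path_support u w -> path_vector u c a b t s v = 0.
Proof.
move=> cu au bw c0 [x|y]; rewrite !inE negb_or => /andP[vx vy] /=.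
  have /norP[xx0 xu] : ~~ ((x == x0) || (x \in u)).
    by apply: contra vx => xu; apply/imfsetP; exists x => //=; rewrite !inE.
  rewrite (negPf xx0) au// /alpha cu// pos_eq0.
    by rewrite !mulr0 !addr0.
  by have := sqsum_ge0 u c; lra.
have /norP[yy0 /norP[yw yu]] : ~~ [|| y == y0, y \in w |
    y \in [fset ysel s | s in fpowerset u]%fset].
  by apply: contra vy => yu; apply/imfsetP; exists y => //=; rewrite !inE.
rewrite (negPf yy0) bw// /beta big_seq_cond big1; first by rewrite !mulr0 !addr0.
move=> z /andP[zu /eqP zy]; move: yu; rewrite -zy.
by rewrite in_imfset.
Qed.

Section Values.
Variables (phi : Y -> set X) (K : simplicial_complex X).
Variables (u : {fset X}) (c a : X -> R) (b : Y -> R) (t s : R).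
Hypotheses (c0 : forall x, 0 <= c x) (a0 : forall x, 0 <= a x).
Hypotheses (b0 : forall y, 0 <= b y).
Hypotheses (t01 : 0 <= t <= 1) (s01 : 0 <= s <= 1).

Lemma coef_ge0 : [/\ 0 <= coef_alpha t s, 0 <= coef_beta t s,
  0 <= coef_a t s & 0 <= coef_b t s].
Proof.
move: t01 s01 => /andP[? ?] /andP[? ?].
by split; rewrite !mulr_ge0 ?pos_ge0 ?capped_ge0 ?subr_ge0.
Qed.

Lemma path_vector_ge0 v : 0 <= path_vector u c a b t s v.
Proof.
have [? ? ? ?] := coef_ge0.
by case: v => [x|y] /=; rewrite !addr_ge0// mulr_ge0// ?pos_ge0 ?alpha_ge0//
   ?beta_ge0.
Qed.

(** A positive coordinate has a positive summand; each alternative records the region of the square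
    where the coefficient of that summand is positive. *)
Lemma path_vector_inl_gt0 x : 0 < path_vector u c a b t s (inl x) ->
  [\/ 3 * t + 3 * s < 1, [/\ 0 < t, 3 * t < 2 & 0 < alpha u c x] |
      3 * t < 1 + 3 * s /\ 0 < a x].
Proof.
have [? ? ? ?] := coef_ge0; move: t01 s01 => /andP[? ?] /andP[? ?].
move=> /= h; have [kx|kx] := ltP 0 (coef_x0 t s).
  by apply: Or31; move: kx; rewrite pos_gt0; lra.
have [/mul_gt0_nneg[]//|al] := ltP 0 (coef_alpha t s * alpha u c x).
  exact: alpha_ge0.
  move=> /mul_gt0_nneg[]; rewrite ?pos_ge0 ?mulr_ge0 ?subr_ge0// => st p ax.
  apply: Or32; split => //; last by rewrite pos_gt0 in p; lra.
  by have [] := mul_gt0_nneg _ _ st; rewrite ?subr_ge0.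
have [/mul_gt0_nneg[]//|?] := ltP 0 (coef_a t s * a x).
  move=> /mul_gt0_nneg[]; rewrite ?capped_ge0// => _; rewrite capped_gt0 => p ax.
  by apply: Or33; split => //; lra.
have : coef_x0 t s = 0 by apply/eqP; rewrite eq_le kx pos_ge0.
by move: h => /[swap] ->; rewrite mul0r; lra.
Qed.

Lemma path_vector_inr_gt0 y : 0 < path_vector u c a b t s (inr y) ->
  [\/ 2 + 3 * s < 3 * t, 1 + 3 * s < 3 * t /\ 0 < beta ysel u c y |
      1 < 3 * t + 3 * s /\ 0 < b y].
Proof.
have [? ? ? ?] := coef_ge0; move: t01 s01 => /andP[? ?] /andP[? ?].
move=> /= h; have [kx|kx] := ltP 0 (coef_y0 t s).
  by apply: Or31; move: kx; rewrite pos_gt0; lra.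
have [/mul_gt0_nneg[]//|al] := ltP 0 (coef_beta t s * beta ysel u c y).
  exact: beta_ge0.
  move=> /mul_gt0_nneg[]; rewrite ?pos_ge0 ?subr_ge0// => st p ax.
  by apply: Or32; split => //; rewrite pos_gt0 in p; lra.
have [/mul_gt0_nneg[]//|?] := ltP 0 (coef_b t s * b y).
  move=> /mul_gt0_nneg[]; rewrite ?capped_ge0// => _; rewrite capped_gt0 => p ax.
  by apply: Or33; split => //; lra.
have : coef_y0 t s = 0 by apply/eqP; rewrite eq_le kx pos_ge0.
by move: h => /[swap] ->; rewrite mul0r; lra.
Qed.

(** Of the nine pairs of terms, six have disjoint regions. For alpha with beta, the face [z] behind
    the beta term contains [x] and lies in [phi (ysel z)]; for alpha with b, positivity of alpha
    passes to [c] and then to [a]; a with b is assumed. *)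
Lemma path_vector_adj x y :
    (forall z, K z -> forall x, x \in z -> phi (ysel z) x) ->
    (forall x, x \notin u -> c x = 0) ->
    (forall x, 0 < c x -> 0 < a x) ->
    (forall x y, 0 < a x -> 0 < b y -> phi y x) ->
    (3 * t < 2 -> \sum_(x <- u) c x = 1) ->
    (1 < 3 * t -> forall z : {fset X}, (forall x, x \in z -> 0 < c x) -> K z) ->
  0 < path_vector u c a b t s (inl x) -> 0 < path_vector u c a b t s (inr y) ->
  phi y x.
Proof.
move=> hsel cu ca ab c1 cK; move: t01 s01 => /andP[? ?] /andP[? ?].
case/path_vector_inl_gt0 => [?|[t0 t2 ax]|[ts ax]];
    case/path_vector_inr_gt0 => [?|[t1 bey]|[ts' bex]]; try by exfalso; lra.
- have [z [zu <- wz]] := beta_gt0 c0 bey.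
  apply: hsel; last exact: (weight_alpha c0 cu (c1 t2) zu wz ax).
  by apply: cK; [lra|have [] := weight_gt0 c0 wz].
- by apply: ab => //; apply: ca; exact: alpha_gt0 ax.
- exact: ab.
Qed.

Lemma path_vector_exists :
    (s = 0 -> t < 1 -> \sum_(x <- u) c x = 1) ->
    (0 < s -> 3 * t <= 1 -> exists x, 0 < a x) ->
    (0 < s -> 1 < 3 * t -> exists y, 0 < b y) ->
  exists v, 0 < path_vector u c a b t s v.
Proof.
move=> c1 ea eb; have [k1 k2 k3 k4] := coef_ge0.
move: t01 s01 => /andP[? ?] /andP[s0 ?].
have kx : 0 <= coef_x0 t s := pos_ge0 _.
have ky : 0 <= coef_y0 t s := pos_ge0 _.
have nx (x : X) : 0 <= (x == x0)%:R :> R := ler0n _ _.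
have ny (y : Y) : 0 <= (y == y0)%:R :> R := ler0n _ _.
have nal x := mulr_ge0 k1 (alpha_ge0 u c x).
have nbe y := mulr_ge0 k2 (beta_ge0 ysel u y c0).
have na x := mulr_ge0 k3 (a0 x); have nb y := mulr_ge0 k4 (b0 y).
have nkx x := mulr_ge0 kx (nx x); have nky y := mulr_ge0 ky (ny y).
move: s0; rewrite le_eqVlt => /predU1P[s0|s0].
  have [t1|t1] := ltP (3 * t) 1.
    have : 0 < coef_x0 t s by rewrite pos_gt0; lra.
    exists (inl x0); have := nal x0; have := na x0.
    by rewrite /= eqxx mulr1; lra.
  have [t2|t2] := ltP (3 * t) 2.
    have [x ax] : exists x, 0 < alpha u c x.
      by apply: alpha_exists => //; apply: c1; lra.
    have : 0 < coef_alpha t s * alpha u c x.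
      apply: mulr_gt0 => //; rewrite -s0 /coef_alpha subr0 mul1r.
      by rewrite mulr_gt0 ?pos_gt0//; lra.
    by exists (inl x); have := nkx x; have := na x; rewrite /=; lra.
  (* At [t = 2/3] both the alpha and the y0 coefficients vanish, and beta carries the path. *)
  move: t2; rewrite le_eqVlt => /predU1P[t2|t2].
    have [y ey] : exists y, 0 < beta ysel u c y.
      by apply: beta_exists => //; apply: c1; lra.
    have : 0 < coef_beta t s * beta ysel u c y.
      apply: mulr_gt0 => //; rewrite -s0 /coef_beta.
      by rewrite mulr_gt0 ?pos_gt0//; lra.
    by exists (inr y); have := nky y; have := nb y; rewrite /=; lra.
  have : 0 < coef_y0 t s by rewrite pos_gt0; lra.
  exists (inr y0); have := nbe y0; have := nb y0.
  by rewrite /= eqxx mulr1; lra.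
have [t1|t1] := leP (3 * t) 1.
  have [x ax] := ea s0 t1.
  have : 0 < coef_a t s * a x by rewrite !mulr_gt0 ?capped_gt0//; lra.
  by exists (inl x); have := nkx x; have := nal x; rewrite /=; lra.
have [y bey] := eb s0 t1.
have : 0 < coef_b t s * b y by rewrite !mulr_gt0 ?capped_gt0//; lra.
by exists (inr y); have := nky y; have := nbe y; rewrite /=; lra.
Qed.

End Values.

Lemma path_vector0 u c a a' b b' t :
  path_vector u c a b t 0 =1 path_vector u c a' b' t 0.
Proof. by case=> v; rewrite /= /coef_a /coef_b !mul0r. Qed.

Lemma path_vector1 u c a b t : 0 <= t <= 1 -> forall v,
  path_vector u c a b t 1 v = match v with inl x => a x | inr y => b y end.
Proof.
move=> /andP[? ?] [v|v]; rewrite /= /coef_x0 /coef_alpha /coef_a /coef_beta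
   /coef_y0 /coef_b.
  rewrite pos_eq0 ?capped_eq1 ?subrr ?mul0r ?add0r ?mul1r//; lra.
rewrite pos_eq0 ?(@pos_eq0 _ (3 * t - 2 - _)) ?capped_eq1 ?mulr0 ?mul0r ?add0r
  ?mul1r//; lra.
Qed.

Lemma path_vector_t0 u c a b v :
  path_vector u c a b 0 0 v = (v == inl x0)%:R.
Proof.
case: v => v; rewrite /= /coef_x0 /coef_alpha /coef_a /coef_beta
   /coef_y0 /coef_b.
  by rewrite !mulr0 !subr0 !mul0r !addr0 /pos (max_idPr ler01) mul1r.
by rewrite !pos_eq0 ?mulr0 ?mul0r ?addr0//; lra.
Qed.

Lemma path_vector_t1 u c a b v :
  path_vector u c a b 1 0 v = (v == inr y0)%:R.
Proof.
case: v => v; rewrite /= /coef_x0 /coef_alpha /coef_a /coef_beta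
   /coef_y0 /coef_b.
  by rewrite !pos_eq0 ?mulr0 ?mul0r ?addr0//; lra.
rewrite subrr !mul0r add0r addr0 (_ : _ - _ = 1).
  by rewrite /pos (max_idPr ler01) mul1r.
lra.
Qed.

Lemma path_vector_incl u u' c a b t s : (u `<=` u')%fset ->
    (forall x, x \notin u -> c x = 0) ->
  path_vector u c a b t s =1 path_vector u' c a b t s.
Proof.
move=> uu' cu [x|y] /=; first by rewrite (alpha_incl uu' cu).
by rewrite (beta_incl _ uu' cu).
Qed.

Section Continuity.
Variables (T : topologicalType) (q : T).

Lemma cvg_pos (f : T -> R) :
  f @ q --> f q -> (fun p => pos (f p)) @ q --> pos (f q).
Proof. exact: cvg_max0. Qed.

Lemma cvg_capped (f : T -> R) :
  f @ q --> f q -> (fun p => capped (f p)) @ q --> capped (f q).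
Proof. by move=> cf; apply: cvg_min1; exact: cvg_pos. Qed.

Lemma cvg_alpha u (c : T -> X -> R) :
    (forall x, (fun p => c p x) @ q --> c q x) ->
  forall x, (fun p => alpha u (c p) x) @ q --> alpha u (c q) x.
Proof.
move=> cc x; apply: cvg_pos; apply: cvgB.
  by apply: cvgM => //; exact: cvg_cst.
by apply: cvg_bigsum => z; apply: cvgM.
Qed.

Lemma cvg_path_vector u (c a : T -> X -> R) (b : T -> Y -> R) (t s : T -> R) :
    (forall x, (fun p => c p x) @ q --> c q x) ->
    (forall x, (fun p => a p x) @ q --> a q x) ->
    (forall y, (fun p => b p y) @ q --> b q y) ->
    t @ q --> t q -> s @ q --> s q ->
  forall v, (fun p => path_vector u (c p) (a p) (b p) (t p) (s p) v) @ q -->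
    path_vector u (c q) (a q) (b q) (t q) (s q) v.
Proof.
move=> cc ca cb ct cs.
have c3t : (fun p => 3 * t p) @ q --> 3 * t q.
  by apply: cvgM => //; exact: cvg_cst.
have c3s : (fun p => 3 * s p) @ q --> 3 * s q.
  by apply: cvgM => //; exact: cvg_cst.
case=> [x|y] /=.
  apply: cvgD; [apply: cvgD|]; apply: cvgM => //; try exact: cvg_cst.
  - apply: cvg_pos; apply: cvgB => //; apply: cvgB => //; exact: cvg_cst.
  - apply: cvgM; first by apply: cvgM => //; apply: cvgB => //; exact: cvg_cst.
    by apply: cvg_pos; apply: cvgB => //; exact: cvg_cst.
  - exact: cvg_alpha.
  - apply: cvgM => //; apply: cvg_capped; apply: cvgB => //.
    by apply: cvgD => //; exact: cvg_cst.
apply: cvgD; [apply: cvgD|]; apply: cvgM => //; try exact: cvg_cst.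
- apply: cvgM; first by apply: cvgB => //; exact: cvg_cst.
  by apply: cvg_pos; apply: cvgB => //; apply: cvgB => //; exact: cvg_cst.
- apply: cvg_bigsum => z; apply: cvgM; first exact: cvg_bigprod.
  apply: cvg_pos; apply: cvgB; first by apply: cvg_bigsum => w; exact: cvgM.
  apply: cvgM; first exact: cvg_cst.
  by apply: cvgB; [exact: cvg_cst|exact: cvg_bigsum].
- by apply: cvg_pos; apply: cvgB => //; apply: cvgB => //; exact: cvg_cst.
- apply: cvgM => //; apply: cvg_capped; apply: cvgB; last exact: cvg_cst.
  exact: cvgD.
Qed.

End Continuity.

End PathVector.

(** * Splitting finite subsets of a disjoint sum *)

Section SumSupport.
Context {X Y : choiceType}.
Implicit Types s : {fset X + Y}.

Definition lefts s : {fset X} :=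
  [fset x in pmap (fun v => if v is inl x then Some x else None) s]%fset.

Definition rights s : {fset Y} :=
  [fset y in pmap (fun v => if v is inr y then Some y else None) s]%fset.

Lemma mem_lefts s x : (x \in lefts s) = (inl x \in s).
Proof.
rewrite inE /= mem_pmap; apply/mapP/idP => [[[z|z] //= zs [->]//]|xs].
by exists (inl x).
Qed.

Lemma mem_rights s y : (y \in rights s) = (inr y \in s).
Proof.
rewrite inE /= mem_pmap; apply/mapP/idP => [[[z|z] //= zs [->]//]|xs].
by exists (inr y).
Qed.

Lemma sum_lefts_rights (R : nmodType) s (F : X + Y -> R) :
  \sum_(v <- s) F v =
  \sum_(x <- lefts s) F (inl x) + \sum_(y <- rights s) F (inr y).
Proof.
rewrite -(big_map inl xpredT F) -(big_map inr xpredT F) -big_cat.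
apply: perm_big; apply: uniq_perm => //.
  rewrite cat_uniq !map_inj_uniq ?fset_uniq ?andbT//=; try by move=> ? ? [].
  by apply/hasPn => _ /mapP[y _ ->]; apply/negP => /mapP[].
move=> v; rewrite mem_cat; apply/idP/orP.
  by case: v => v vs; [left|right]; apply: map_f; rewrite ?mem_lefts ?mem_rights.
by move=> [] /mapP[z + ->]; rewrite ?mem_lefts ?mem_rights.
Qed.

End SumSupport.

(** * The homotopy equivalence *)

Section NonmembershipGraph.
Context {R : realType} {X Y : choiceType} (phi : Y -> set X).
Context (K : simplicial_complex X) (x0 : X).
Hypothesis hK : forall s : {fset X}, K s <-> exists y : Y, [set` s] `<=` phi y.

Local Notation L := (independence_complex (nonmembership_graph phi)).
Local Notation I := (unit_interval R).
Local Notation KR := (realization R K).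
Local Notation LR := (realization R L).

Implicit Types (p : LR) (q : KR).

Let xpart p x := bary p (inl x).
Let ypart p y := bary p (inr y).

Let simplexP (s : {fset X + Y}) :
  L s <-> forall x y, inl x \in s -> inr y \in s -> phi y x.
Proof.
split=> [Ls x y xs ys|sphi [x|y] [x'|y'] us vs //=].
- by apply: contrapT => nphi; exact: (Ls _ _ xs ys).
- by apply; exact: sphi.
- by apply; exact: sphi.
Qed.

Let parts_adj p x y : 0 < xpart p x -> 0 < ypart p y -> phi y x.
Proof.
move=> px py; have /simplexP := carrier_simplex p; apply.
  by rewrite mem_carrier gt_eqF.
by rewrite mem_carrier gt_eqF.
Qed.

(** A vertex [y] in the carrier of [p] is itself a witness for [hK]. *)
Let K_of_neighbor p y (z : {fset X}) : 0 < ypart p y ->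
  (forall x, x \in z -> 0 < xpart p x) -> K z.
Proof.
by move=> py pz; apply/hK; exists y => x /= /pz px; exact: parts_adj px py.
Qed.

Let ray_exists_L (s : {fset X + Y}) (a : X + Y -> R) : (forall v, 0 <= a v) ->
    (forall v, v \notin s -> a v = 0) -> (exists v, 0 < a v) ->
    (forall x y, 0 < a (inl x) -> 0 < a (inr y) -> phi y x) ->
  exists p, ray p a.
Proof.
move=> a0 as0 av aphi; apply: ray_exists a0 as0 av _ => t ta.
by apply/simplexP => x y /ta ax /ta ay; exact: aphi ax ay.
Qed.

Let vertex_exists (v : X + Y) : exists p, ray p (fun w => (w == v)%:R).
Proof.
apply: (@ray_exists_L [fset v]%fset).
- by move=> w; exact: ler0n.
- by move=> w; rewrite inE => /negPf ->.
- by exists v; rewrite eqxx ltr01.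
- by move=> x y; case: v => v /=; [move=> _|]; rewrite ltxx.
Qed.

(** * The map to the suspension *)

Definition ymass p := \sum_(y <- rights (carrier p)) ypart p y.

Let parts_sum p : \sum_(x <- lefts (carrier p)) xpart p x = 1 - ymass p.
Proof.
by rewrite -(bary_sum (fsubset_refl (carrier p))) sum_lefts_rights addrK.
Qed.

Let ymass_carrier p s : (carrier p `<=` s)%fset ->
  ymass p = \sum_(y <- rights s) ypart p y.
Proof.
move=> ps; apply: big_fset_incl.
  by apply/fsubsetP => y; rewrite !mem_rights; exact: (fsubsetP ps).
by move=> y _; rewrite mem_rights => /bary_eq0.
Qed.

Let ymass_gt0 p : 0 < ymass p -> exists y, 0 < ypart p y.
Proof.
move=> m0; apply: contrapT => nex; suff m1 : ymass p = 0 by rewrite m1 ltxx in m0.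
rewrite /ymass big1// => y _; apply/eqP; rewrite eq_le bary_ge0 andbT leNgt.
by apply/negP => py; apply: nex; exists y.
Qed.

Let ymass_lt1 p : ymass p < 1 -> exists x, 0 < xpart p x.
Proof.
rewrite -subr_gt0 -parts_sum => m0; apply: contrapT => nex.
move: m0; rewrite big1 ?ltxx// => x _.
apply/eqP; rewrite eq_le bary_ge0 andbT leNgt.
by apply/negP => py; apply: nex; exists x.
Qed.

Let ymass_eq0 p : (forall y, ypart p y = 0) -> ymass p = 0.
Proof. by move=> py; rewrite /ymass big1. Qed.

Let ymass_eq1 p : (forall x, xpart p x = 0) -> ymass p = 1.
Proof. by move=> px; apply/eqP; rewrite eq_sym -subr_eq0 -parts_sum big1. Qed.

Let ymass_continuous : continuous ymass.
Proof.
apply: (final_continuous closed_simplex_final) => s q.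
rewrite (_ : ymass \o _ = fun p : closed_simplex _ =>
    \sum_(y <- rights (sval s)) ypart (simplex_incl p) y); last first.
  by apply/funext => p /=; rewrite (ymass_carrier (carrier_simplex_incl p)).
apply: cvg_bigsum => y; exact: bary_simplex_continuous.
Qed.

(** The affine map sends 1/4 to 0 and 3/4 to 1, so [level] is constant near mass 0 and mass 1, where
    the X-part or the Y-part may vanish. *)
Definition level p : R := clamp (2 * ymass p - 1 / 2).

Let level01 p : 0 <= level p <= 1.
Proof. exact: (unit_itvP (to_itv (2 * ymass p - 1 / 2))). Qed.

Let level_continuous : continuous level.
Proof.
move=> p; apply: (cvg_comp ymass (fun r : R => clamp (2 * r - 1 / 2))).
  exact: ymass_continuous.
apply: cvg_clamp; apply: cvgB; last exact: cvg_cst.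
by apply: cvgM; [exact: cvg_cst|exact: cvg_id].
Qed.

Let level_low p : ymass p <= 1 / 4 -> level p = 0.
Proof.
move=> m; rewrite /level /clamp (max_idPl _)// ge_min.
by apply/orP; right; lra.
Qed.

Let level_high p : 3 / 4 <= ymass p -> level p = 1.
Proof.
by move=> m; rewrite /level /clamp (min_idPl _) ?(max_idPr _)//; lra.
Qed.

Let level_lt1 p : level p < 1 -> ymass p < 3 / 4.
Proof. by rewrite !ltNge; apply: contra => /level_high ->. Qed.

Let level_gt0 p : 0 < level p -> 1 / 4 < ymass p.
Proof. by rewrite !ltNge; apply: contra => /level_low ->. Qed.

Let xray_exists p : 0 < ymass p < 1 -> exists q, ray q (xpart p).
Proof.
move=> /andP[/ymass_gt0[y py] /ymass_lt1 px].
apply: (@ray_exists _ _ _ (lefts (carrier p))) => //.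
- by move=> x; exact: bary_ge0.
- by move=> x; rewrite mem_lefts => /bary_eq0.
- by move=> z; exact: K_of_neighbor py.
Qed.

(** By [xray_exists] the fallback occurs only at mass 0 or 1, and the comparison with 1/2 then names
    the pole. *)
Definition collapse p : suspension R KR :=
  if pselect (exists q, ray q (xpart p)) is left e
  then meridian (projT1 (cid e)) (to_itv (level p)) else pole (1 / 2 < ymass p).

Let collapse_ray p q : ray q (xpart p) ->
  collapse p = meridian q (to_itv (level p)).
Proof.
move=> pq; rewrite /collapse; case: pselect => [e|[]]; last by exists q.
by congr meridian; exact: ray_unique (projT2 (cid e)) pq.
Qed.

Let collapse_low p : ymass p <= 1 / 4 -> collapse p = pole false.
Proof.
move=> m; rewrite /collapse; case: pselect => [e|_].
  by apply: meridian0; rewrite val_to_itv level_low// clamp_id ?lexx ?ler01.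
by congr pole; apply/negbTE; rewrite -leNgt; lra.
Qed.

Let collapse_high p : 3 / 4 <= ymass p -> collapse p = pole true.
Proof.
move=> m; rewrite /collapse; case: pselect => [e|_].
  by apply: meridian1; rewrite val_to_itv level_high// clamp_id ?lexx ?ler01.
by congr pole; lra.
Qed.

Let collapse_cvg (T : topologicalType) (inc : T -> LR) (s : {fset X + Y}) z :
    (forall z, (carrier (inc z) `<=` s)%fset) -> continuous inc ->
    (forall v, continuous (fun z => bary (inc z) v)) ->
  (fun z => collapse (inc z)) @ z --> collapse (inc z).
Proof.
move=> incs cinc cbary.
have cm : (fun z => ymass (inc z)) @ z --> ymass (inc z).
  by apply: (cvg_comp inc ymass); [exact: cinc|exact: ymass_continuous].
have [m1|m1] := ltP (ymass (inc z)) (1 / 4).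
  rewrite collapse_low ?ltW//.
  apply: (@cvg_trans _ ((cst (pole false)) @ z)); last exact: cvg_cst.
  apply: near_eq_cvg; near=> z' => /=; rewrite collapse_low//; apply: ltW.
  by near: z'; exact: (cvgr_lt _ cm).
have [m2|m2] := ltP (3 / 4) (ymass (inc z)).
  rewrite collapse_high ?ltW//.
  apply: (@cvg_trans _ ((cst (pole true)) @ z)); last exact: cvg_cst.
  apply: near_eq_cvg; near=> z' => /=; rewrite collapse_high//; apply: ltW.
  by near: z'; exact: (cvgr_gt _ cm).
(* The mass is now in [[1/4, 3/4]], hence strictly between 0 and 1 near [z]. The point [q0] is a
   default that makes the selection [sel] total. *)
have [q0 zq0] : exists q, ray q (xpart (inc z)) by apply: xray_exists; lra.
have /choice[sel selP] (z' : T) :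
    exists q, 0 < ymass (inc z') < 1 -> ray q (xpart (inc z')).
  have [/xray_exists[q ?]|] := boolP (0 < ymass (inc z') < 1); first by exists q.
  by move=> _; exists q0.
have near01 : \forall z' \near z, 0 < ymass (inc z') < 1.
  near=> z'; apply/andP; split; near: z'.
    by apply: (cvgr_gt _ cm); lra.
  by apply: (cvgr_lt _ cm); lra.
have csel : sel @ z --> sel z.
  apply: (@cvg_ray _ _ _ _ _ (fun z' => xpart (inc z')) z (lefts s)).
  - by near=> z'; apply: selP; near: z'.
  - apply: nearW => z' x; rewrite mem_lefts => xs.
    by apply: bary_eq0; apply: contra xs; apply: (fsubsetP (incs z')).
  - by move=> x; exact: cbary.
rewrite (collapse_ray (selP z (nbhs_singleton near01))).
apply: (@cvg_trans _ ((fun z' => meridian (sel z') (to_itv (level (inc z')))) @ z)).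
  apply: near_eq_cvg; near=> z' => /=; apply/esym/collapse_ray/selP.
  by near: z'.
apply: cvg_meridian => //.
apply: (cvg_comp (fun z' => level (inc z')) to_itv); last exact: to_itv_continuous.
by apply: (cvg_comp inc level); [exact: cinc|exact: level_continuous].
Unshelve. all: by end_near.
Qed.

Let collapse_continuous : continuous collapse.
Proof.
apply: (final_continuous closed_simplex_final) => s z.
have [ci _ _] := @closed_simplex_final R _ L.
apply: (@collapse_cvg _ _ (sval s) z) => [w||v].
- exact: carrier_simplex_incl.
- exact: ci.
- exact: bary_simplex_continuous.
Qed.

Section Homotopies.
Context (y0 : Y) (ysel : {fset X} -> Y).
Hypothesis hsel : forall z, K z -> forall x, x \in z -> phi (ysel z) x.

Local Notation PV := (path_vector ysel x0 y0).

Let unit0 : 0 <= (0 : R) <= 1. Proof. by rewrite lexx ler01. Qed.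

(** * The map from the suspension *)

Let spread_exists q (t : R) : 0 <= t <= 1 ->
  exists p, ray p (PV (carrier q) (bary q) (bary q) (fun=> 0) t 0).
Proof.
(* At [s = 0] the end vectors have coefficient zero; taking [bary q] and 0 for them makes the
   conditions on them immediate. *)
move=> t01; have q0 := bary_ge0 q; have qs := @bary_eq0 _ _ _ q.
have q1 := bary_sum (fsubset_refl (carrier q)).
apply: (ray_exists_L (s := path_support ysel x0 y0 (carrier q) fset0)).
- by move=> v; apply: path_vector_ge0.
- exact: path_vector_support.
- by apply: path_vector_exists => //; rewrite ltxx.
- move=> x y; apply: (path_vector_adj (K := K)) => //.
    by move=> ? ?; rewrite ltxx.
  by move=> _ z; exact: simplex_of_pos.
Qed.

Definition spread q (t : I) : LR :=
  projT1 (cid (spread_exists q (unit_itvP t))).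

(** Freedom in [u] serves continuity on a closed simplex; freedom in [a] and [b] allows comparison
    with [contract] at its start. *)
Let spreadP q (t : I) (u : {fset X}) a b : (carrier q `<=` u)%fset ->
  ray (spread q t) (PV u (bary q) a b (set_val t) 0).
Proof.
move=> qu; apply: eq_ray (projT2 (cid (spread_exists q (unit_itvP t)))) => v.
rewrite (path_vector0 _ _ _ _ _ _ a _ b).
by apply: path_vector_incl => //; exact: bary_eq0.
Qed.

Definition apex (b : bool) : LR :=
  projT1 (cid (vertex_exists (if b then inr y0 else inl x0))).

Let apexP b :
  ray (apex b) (fun w => (w == if b then inr y0 else inl x0)%:R).
Proof. exact: projT2 (cid (vertex_exists (if b then inr y0 else inl x0))). Qed.

Let spread0 q (t : I) : set_val t = 0 :> R -> spread q t = apex false.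
Proof.
move=> t0; have := spreadP t (bary q) (fun=> 0) (fsubset_refl (carrier q)).
rewrite t0 => /ray_unique; apply; apply: eq_ray (apexP _) => v.
by rewrite path_vector_t0.
Qed.

Let spread1 q (t : I) : set_val t = 1 :> R -> spread q t = apex true.
Proof.
move=> t1; have := spreadP t (bary q) (fun=> 0) (fsubset_refl (carrier q)).
rewrite t1 => /ray_unique; apply; apply: eq_ray (apexP _) => v.
by rewrite path_vector_t1.
Qed.

Let spread_continuous : continuous (fun r : KR * I => spread r.1 r.2).
Proof.
apply: realization_prod_continuous.
  exact: unit_interval_compact_neighborhoods.
move=> T inc g s z incs cinc cg /=.
apply: (@cvg_ray _ _ _ _ _ (fun w =>
  PV s (bary (inc w)) (bary (inc w)) (fun=> 0) (set_val (g w)) 0) z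
  (path_support ysel x0 y0 s fset0)).
- by apply: nearW => w; exact: spreadP.
- apply: nearW => w; apply: path_vector_support => //.
  + by move=> x /(contra (fsubsetP (incs w) x)); exact: bary_eq0.
  + by move=> x /(contra (fsubsetP (incs w) x)); exact: bary_eq0.
  + by move=> x; exact: bary_ge0.
- apply: cvg_path_vector => // [y||]; [exact: cvg_cst|exact: cvg_set_val|].
  exact: cvg_cst.
Qed.

Definition expand : suspension R KR -> LR := suspension_rec spread apex.

Let expand_meridian q t : expand (meridian q t) = spread q t.
Proof. exact: suspension_rec_meridian. Qed.

Let expand_pole b : expand (pole b) = apex b.
Proof. exact: suspension_rec_pole. Qed.

Let expand_continuous : continuous expand.
Proof.
apply: suspension_continuous.
rewrite (_ : (fun z => _) = fun r : KR * I => spread r.1 r.2)//.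
by apply/funext => r; exact: expand_meridian.
Qed.

(* Equal to [1 - m] for [m <= 3/4], but bounded away from [0]. *)
Let den (m : R) := 1 / 4 + pos (3 / 4 - m).

Let den_gt0 m : 0 < den m.
Proof. by rewrite /den; have := pos_ge0 (3 / 4 - m); lra. Qed.

Let denE m : m <= 3 / 4 -> den m = 1 - m.
Proof. by move=> m34; rewrite /den /pos (max_idPr _); lra. Qed.

(** * The homotopy on the independence complex *)

Let nx p x := xpart p x / den (ymass p).

Let nx_ge0 p x : 0 <= nx p x.
Proof. by rewrite divr_ge0 ?bary_ge0// ltW. Qed.

Let nx_gt0 p x : 0 < nx p x -> 0 < xpart p x.
Proof. by rewrite /nx pmulr_lgt0// invr_gt0. Qed.

Let nx_eq0 p x : x \notin lefts (carrier p) -> nx p x = 0.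
Proof. by rewrite mem_lefts => /bary_eq0 px; rewrite /nx /xpart px mul0r. Qed.

Let nx_sum p : level p < 1 -> \sum_(x <- lefts (carrier p)) nx p x = 1.
Proof.
move=> /level_lt1 m; rewrite -mulr_suml parts_sum denE ?ltW//.
by rewrite divff// subr_eq0; apply/eqP; lra.
Qed.

(** The vector starts at the path point of the normalized X-part at time [level p] and ends at [p].
    Bounds on [level p] become bounds on the mass, which supply the nonzero parts needed. *)
Let contract_exists p (s : R) : 0 <= s <= 1 ->
  exists p', ray p' (PV (lefts (carrier p)) (nx p) (xpart p) (ypart p)
    (level p) s).
Proof.
move=> s01; have x0' x : 0 <= xpart p x := bary_ge0 p (inl x).
have y0' y : 0 <= ypart p y := bary_ge0 p (inr y).
have t01 := level01 p; have n0 := nx_ge0 p; have n1 := @nx_eq0 p.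
apply: (ray_exists_L (s :=
  path_support ysel x0 y0 (lefts (carrier p)) (rights (carrier p)))).
- by move=> v; apply: path_vector_ge0.
- apply: path_vector_support => //.
    by move=> x; rewrite mem_lefts => /bary_eq0.
  by move=> y; rewrite mem_rights => /bary_eq0.
- apply: path_vector_exists => // [_|_ t3|_ t3].
  + exact: nx_sum.
  + by apply: ymass_lt1; have /level_lt1 : level p < 1; lra.
  + by apply: ymass_gt0; have /level_gt0 : 0 < level p; lra.
- move=> x y; apply: (path_vector_adj (K := K)) => //.
  + exact: nx_gt0.
  + exact: parts_adj.
  + by move=> t3; apply: nx_sum; lra.
  (* A level above 1/3 forces positive mass on some [y'], which is a common witness for the face
     [z]. *)
  + move=> t3 z zc; have [y' py'] : exists y', 0 < ypart p y'.
      by apply: ymass_gt0; have /level_gt0 : 0 < level p; lra.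
    by apply: (K_of_neighbor py') => w /zc; exact: nx_gt0.
Qed.

Definition contract (r : LR * I) : LR :=
  projT1 (cid (contract_exists r.1 (unit_itvP r.2))).

Let contractP r : ray (contract r) (PV (lefts (carrier r.1)) (nx r.1)
  (xpart r.1) (ypart r.1) (level r.1) (set_val r.2)).
Proof. exact: projT2 (cid (contract_exists r.1 (unit_itvP r.2))). Qed.

Let contract_continuous : continuous contract.
Proof.
apply: realization_prod_continuous.
  exact: unit_interval_compact_neighborhoods.
move=> T inc g s z incs cinc cg /=.
have incl w : (lefts (carrier (inc w)) `<=` lefts s)%fset.
  by apply/fsubsetP => x; rewrite !mem_lefts; exact: (fsubsetP (incs w)).
have cm : (fun w => ymass (inc w)) @ z --> ymass (inc z).
  rewrite (ymass_carrier (incs z)).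
  rewrite (_ : (fun w => _) = fun w => \sum_(y <- rights s) ypart (inc w) y).
    by apply: cvg_bigsum => y; exact: cinc.
  by apply/funext => w; exact: ymass_carrier (incs w).
have clev : (fun w => level (inc w)) @ z --> level (inc z).
  apply: cvg_clamp; apply: cvgB; last exact: cvg_cst.
  by apply: cvgM; [exact: cvg_cst|exact: cm].
have cnx x : (fun w => nx (inc w) x) @ z --> nx (inc z) x.
  apply: cvgM; first exact: cinc.
  apply: cvgV; first by rewrite gt_eqF.
  apply: cvgD; first exact: cvg_cst.
  by apply: cvg_pos; apply: cvgB => //; exact: cvg_cst.
apply: (@cvg_ray _ _ _ _ _ (fun w => PV (lefts s) (nx (inc w)) (xpart (inc w))
    (ypart (inc w)) (level (inc w)) (set_val (g w))) z
  (path_support ysel x0 y0 (lefts s) (rights s))).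
- apply: nearW => w; apply: eq_ray (contractP (inc w, g w)) => v /=.
  by apply: path_vector_incl => //; exact: nx_eq0.
- apply: nearW => w; apply: path_vector_support => //.
  + by move=> x /(contra (fsubsetP (incl w) x)); exact: nx_eq0.
  + move=> x; rewrite mem_lefts => /(contra (fsubsetP (incs w) _)).
    exact: bary_eq0.
  + move=> y; rewrite mem_rights => /(contra (fsubsetP (incs w) _)).
    exact: bary_eq0.
- apply: cvg_path_vector => //.
  + by move=> x; exact: cinc.
  + by move=> y; exact: cinc.
  + exact: cvg_set_val.
Qed.

Let contract0 p (s : I) : set_val s = 0 :> R ->
  contract (p, s) = expand (collapse p).
Proof.
move=> s0; have := contractP (p, s); rewrite /= s0 => cp.
have [m1|m1] := leP (ymass p) (1 / 4).
  rewrite collapse_low// expand_pole; apply: ray_unique cp _.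
  by apply: eq_ray (apexP false) => v; rewrite level_low// path_vector_t0.
have [m2|m2] := leP (3 / 4) (ymass p).
  rewrite collapse_high// expand_pole; apply: ray_unique cp _.
  by apply: eq_ray (apexP true) => v; rewrite level_high// path_vector_t1.
have [q pq] : exists q, ray q (xpart p) by apply: xray_exists; lra.
rewrite (collapse_ray pq) expand_meridian; apply: ray_unique cp _.
have [k k0 kE] := pq.
have qp : (carrier q `<=` lefts (carrier p))%fset.
  apply/fsubsetP => x; rewrite mem_lefts !mem_carrier; apply: contra_neq => px.
  by apply: (@mulfI _ k); rewrite ?gt_eqF// -kE mulr0.
(* Both sides are the total mass of the X-part, so dividing by either gives the coordinates of
   [q]. *)
have kden : k = den (ymass p).
  rewrite denE ?ltW// -parts_sum; under eq_bigr do rewrite kE.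
  by rewrite -mulr_sumr bary_sum ?mulr1.
have nxq : nx p =1 bary q.
  by move=> x; rewrite /nx kE -kden mulrAC divff ?mul1r// gt_eqF.
apply: eq_ray (spreadP _ (xpart p) (ypart p) qp) => v.
by rewrite val_to_itv clamp_id// (funext nxq).
Qed.

Let contract1 p (s : I) : set_val s = 1 :> R -> contract (p, s) = p.
Proof.
move=> s1; have := contractP (p, s); rewrite /= s1 => /ray_unique; apply.
apply: eq_ray (ray_bary p) => v; rewrite path_vector1//.
by case: v.
Qed.

(** * The homotopy on the suspension *)

Let slide_exists q (s : R) : 0 <= s <= 1 -> exists q', ray q'
  (fun x => (1 - s) * alpha (carrier q) (bary q) x + s * bary q x).
Proof.
move=> /andP[s0 s1]; have q0 := bary_ge0 q.
have al0 := alpha_ge0 (carrier q) (bary q).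
have [x ax] := alpha_exists q0 (bary_sum (fsubset_refl (carrier q))).
have qx := alpha_gt0 ax.
apply: (@ray_exists _ _ _ (carrier q)) => [w|w|| z zq].
- by rewrite addr_ge0 ?mulr_ge0 ?subr_ge0.
- move=> /bary_eq0 qw; rewrite qw mulr0 addr0.
  rewrite (_ : alpha _ _ w = 0) ?mulr0//.
  apply/eqP; rewrite eq_le al0 andbT leNgt; apply/negP => /alpha_gt0.
  by rewrite qw ltxx.
- exists x; move: s0; rewrite le_eqVlt => /predU1P[<-|s0].
    by rewrite subr0 mul1r mul0r addr0.
  by rewrite ltr_wpDl ?mulr_gt0 ?mulr_ge0 ?subr_ge0.
- apply: (simplex_of_pos (p := q)) => w /zq h.
  rewrite lt_neqAle q0 andbT; apply: contraTneq h => qw.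
  rewrite -qw mulr0 addr0 -leNgt.
  rewrite (_ : alpha _ _ w = 0) ?mulr0//.
  apply/eqP; rewrite eq_le al0 andbT leNgt; apply/negP => /alpha_gt0.
  by rewrite -qw ltxx.
Qed.

Definition slide (r : KR * I) : KR :=
  projT1 (cid (slide_exists r.1 (unit_itvP r.2))).

Let slideP q (s : I) u : (carrier q `<=` u)%fset -> ray (slide (q, s))
  (fun x => (1 - set_val s) * alpha u (bary q) x + set_val s * bary q x).
Proof.
move=> qu; apply: eq_ray (projT2 (cid (slide_exists q (unit_itvP s)))) => x.
by rewrite (alpha_incl qu)//; exact: bary_eq0.
Qed.

Let slide_continuous : continuous slide.
Proof.
apply: realization_prod_continuous.
  exact: unit_interval_compact_neighborhoods.
move=> T inc g s z incs cinc cg /=.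
have cg' : (fun w => set_val (g w)) @ z --> set_val (g z).
  exact: cvg_set_val.
have cz w x : x \notin s -> bary (inc w) x = 0.
  by move=> /(contra (fsubsetP (incs w) x)); exact: bary_eq0.
apply: (@cvg_ray _ _ _ _ _ (fun w x => (1 - set_val (g w)) *
  alpha s (bary (inc w)) x + set_val (g w) * bary (inc w) x) z s).
- by apply: nearW => w; exact: slideP.
- apply: nearW => w x xs; rewrite /alpha cz// pos_eq0 ?mulr0 ?addr0//.
  by have := sqsum_ge0 s (bary (inc w)); lra.
- move=> x; apply: cvgD; last exact: cvgM.
  by apply: cvgM; [apply: cvgB => //; exact: cvg_cst|exact: cvg_alpha].
Qed.

Let path_level q (t s : I) : R :=
  (1 - set_val s) * level (spread q t) + set_val s * set_val t.

(** The base moves from the normalized [alpha] to [q] inside the carrier of [q], and the height from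
    the level of [spread q t] to [t]. At either end of the meridian the two heights agree, so the
    poles stay fixed. *)
Definition unroll (w : suspension R KR) : I -> suspension R KR :=
  suspension_rec
    (fun q t s => meridian (slide (q, s)) (to_itv (path_level q t s)))
    (fun b _ => pole b) w.

Let ray_ymass0 p a : ray p a -> (forall y, a (inr y) = 0) -> ymass p = 0.
Proof.
move=> [c c0 pa] ay; apply: ymass_eq0 => y.
by apply: (@mulfI _ c); rewrite ?gt_eqF// -pa ay mulr0.
Qed.

Let ray_ymass1 p a : ray p a -> (forall x, a (inl x) = 0) -> ymass p = 1.
Proof.
move=> [c c0 pa] ax; apply: ymass_eq1 => x.
by apply: (@mulfI _ c); rewrite ?gt_eqF// -pa ax mulr0.
Qed.

Let level_apex b : level (apex b) = b%:R.
Proof.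
case: b; last by apply: level_low; rewrite (ray_ymass0 (apexP false))//; lra.
by apply: level_high; rewrite (ray_ymass1 (apexP true))//; lra.
Qed.

Let unroll_meridian q t s : unroll (meridian q t) s =
  meridian (slide (q, s)) (to_itv (path_level q t s)).
Proof.
rewrite /unroll suspension_rec_meridian// => x r re; apply/funext => s'.
  apply: meridian0; rewrite val_to_itv /path_level spread0// re level_apex.
  by rewrite !mulr0 addr0 clamp_id.
apply: meridian1; rewrite val_to_itv /path_level spread1// re level_apex.
by rewrite !mulr1 subrK clamp_id// lexx ler01.
Qed.

Let unroll_pole b s : unroll (pole b) s = pole b.
Proof.
rewrite /unroll suspension_rec_pole// => x r re; apply/funext => s'.
  apply: meridian0; rewrite val_to_itv /path_level spread0// re level_apex.
  by rewrite !mulr0 addr0 clamp_id.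
apply: meridian1; rewrite val_to_itv /path_level spread1// re level_apex.
by rewrite !mulr1 subrK clamp_id// lexx ler01.
Qed.

Let unroll_continuous :
  continuous (fun r : suspension R KR * I => unroll r.1 r.2).
Proof.
apply: suspension_homotopy_continuous => [|b]; last first.
  rewrite (_ : (fun s => _) = cst (pole b)); first exact: cst_continuous.
  by apply/funext => s; rewrite unroll_pole.
rewrite (_ : (fun z => _) = fun r : KR * I * I => meridian (slide (r.1.1, r.2))
    (to_itv (path_level r.1.1 r.1.2 r.2))); last first.
  by apply/funext => r; rewrite unroll_meridian.
apply: (meridian_homotopy_continuous
  (g := fun r => level (spread r.1 r.2))) => [|r].
  exact: slide_continuous.
apply: (cvg_comp (fun r : KR * I => spread r.1 r.2) level).
  exact: spread_continuous.
exact: level_continuous.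
Qed.

Let unroll0 w (s : I) : set_val s = 0 :> R -> unroll w s = collapse (expand w).
Proof.
move=> s0; move: w; apply: suspension_case => [q t|b]; last first.
  rewrite unroll_pole expand_pole; case: b.
    by rewrite collapse_high// (ray_ymass1 (apexP true))//; lra.
  by rewrite collapse_low// (ray_ymass0 (apexP false))//; lra.
rewrite unroll_meridian expand_meridian /path_level s0 subr0 mul1r mul0r addr0.
have sP := spreadP t (bary q) (fun=> 0) (fsubset_refl (carrier q)).
have /andP[t0 t1] := unit_itvP t.
(* The first third of the path has no mass on Y and the last third none on X, so both collapse to
   poles. In the middle third the X-part is a multiple of [alpha]. *)
have [t3|t3] := ltP (3 * (set_val t : R)) 1.
  have m0 : ymass (spread q t) = 0.
    apply: (ray_ymass0 sP) => y /=.
    by rewrite /coef_beta /coef_y0 !pos_eq0 ?mulr0 ?mul0r ?addr0//; lra.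
  have ml : ymass (spread q t) <= 1 / 4 by rewrite m0; lra.
  rewrite (collapse_low ml) (level_low ml).
  by rewrite meridian0// val_to_itv clamp_id.
have [t2|t2] := leP 2 (3 * (set_val t : R)).
  have m1 : ymass (spread q t) = 1.
    apply: (ray_ymass1 sP) => x /=.
    rewrite /coef_x0 /coef_alpha /coef_a mul0r.
    by rewrite !pos_eq0 ?mulr0 ?mul0r ?addr0//; lra.
  have mh : 3 / 4 <= ymass (spread q t) by rewrite m1; lra.
  rewrite (collapse_high mh) (level_high mh).
  by rewrite meridian1// val_to_itv clamp_id// lexx ler01.
have k0 : 0 < coef_alpha (set_val t : R) 0.
  by rewrite /coef_alpha subr0 mul1r mulr_gt0 ?pos_gt0//; lra.
apply/esym/collapse_ray.
have [c c0 sE] := sP; have [d d0 dE] := slideP s (fsubset_refl (carrier q)).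
(* Here [c] normalizes the path vector and [d] normalizes [alpha]. *)
exists (c^-1 * (coef_alpha (set_val t : R) 0 * d)) => [|x].
  by rewrite mulr_gt0 ?invr_gt0// (mulr_gt0 k0 d0).
apply: (@mulfI _ c); first by rewrite gt_eqF.
rewrite -sE /= /coef_x0 /coef_a pos_eq0 ?mul0r ?add0r ?addr0; last by lra.
rewrite !mulrA divff ?gt_eqF// mul1r -mulrA -dE s0.
by rewrite /coef_alpha !subr0 !mul1r mul0r addr0.
Qed.

Let unroll1 w (s : I) : set_val s = 1 :> R -> unroll w s = w.
Proof.
move=> s1; move: w; apply: suspension_case => [q t|b]; last by rewrite unroll_pole.
rewrite unroll_meridian /path_level s1 subrr mul0r add0r mul1r to_itvK.
congr meridian; have := slideP s (fsubset_refl (carrier q)).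
rewrite s1 => /ray_unique; apply; apply: eq_ray (ray_bary q) => x.
by rewrite subrr mul0r add0r mul1r.
Qed.

Lemma independence_complex_suspension :
  homotopy_equivalent R LR (suspension R KR).
Proof.
exists collapse, expand; split.
- exact: collapse_continuous.
- exact: expand_continuous.
- exists contract; split => [|p s s0|p s s1].
  + exact: contract_continuous.
  + exact: contract0.
  + exact: contract1.
- exists (fun r => unroll r.1 r.2); split => [|w s s0|w s s1] /=.
  + exact: unroll_continuous.
  + exact: unroll0.
  + exact: unroll1.
Qed.

End Homotopies.

End NonmembershipGraph.

Theorem theorem3p1 (R : realType) (X Y : choiceType) (phi : Y -> set X)
    (K : simplicial_complex X) (hX : inhabited X)
    (hK : forall s : {fset X}, K s <-> exists y : Y, [set` s] `<=` phi y) :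
  homotopy_equivalent R
    (realization R (independence_complex (nonmembership_graph phi)))
    (suspension R (realization R K)).
Proof.
(* The empty simplex of [K] yields a [y0], which also serves as the value of [ysel] off [K]. *)
have [x0] := hX; have /hK[y0 _] := simplices_fset0 K.
have /choice[ysel hsel] (z : {fset X}) :
    exists y, K z -> forall x, x \in z -> phi y x.
  have [/hK[y zy]|nKz] := pselect (K z); last by exists y0.
  by exists y => _ x xz; exact: zy.
exact: (independence_complex_suspension x0 hK y0 hsel).
Qed.
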